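(* Let $\gamma_1,\gamma_2,\gamma_3,\delta_2,\delta_3,x,y\in\mathbb{C}$, let $\alpha_1,\dots,\alpha_4,\beta_1,\dots,\beta_4$ be positive real numbers, and let $\mu_1,\mu_2\in\mathbb{C}$ with $\operatorname{Re}\mu_1>0$ and $\operatorname{Re}\mu_2>0$. Then $$D_1\left(\begin{matrix}\gamma_1,\alpha_1,\beta_1;\gamma_2,\alpha_2;\gamma_3,\beta_2;\\ \mu_1+\mu_2,\alpha_3,\beta_3;\delta_2,\alpha_4;\delta_3,\beta_4;\end{matrix}\left|\begin{matrix}x\\ y\end{matrix}\right.\right)=\int_0^1\xi^{\mu_1-1}(1-\xi)^{\mu_2-1}D_2\left(\begin{matrix}\gamma_1,\alpha_1,\beta_1;\gamma_2,\alpha_2;\gamma_3,\beta_2;\\ \mu_1,\alpha_3;\mu_2,\beta_3;\delta_2,\alpha_4;\delta_3,\beta_4;\end{matrix}\left|\begin{matrix}x\xi^{\alpha_3}\\ y(1-\xi)^{\beta_3}\end{matrix}\right.\right)d\xi.$$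
   Context: $(\gamma)_\lambda=\Gamma(\gamma+\lambda)/\Gamma(\gamma)$ for $\gamma\in\mathbb{C}$ and real $\lambda\ge0$. For complex $\gamma_i,\delta_i,x,y$ and positive real $\alpha_i,\beta_i$, $$D_1\left(\begin{matrix}\gamma_1,\alpha_1,\beta_1;\gamma_2,\alpha_2;\gamma_3,\beta_2;\\ \delta_1,\alpha_3,\beta_3;\delta_2,\alpha_4;\delta_3,\beta_4;\end{matrix}\left|\begin{matrix}x\\ y\end{matrix}\right.\right)=\sum_{m,n=0}^{\infty}\frac{(\gamma_1)_{\alpha_1 m+\beta_1 n}(\gamma_2)_{\alpha_2 m}(\gamma_3)_{\beta_2 n}}{\Gamma(\delta_1+\alpha_3 m+\beta_3 n)}\frac{x^m}{\Gamma(\delta_2+\alpha_4 m)}\frac{y^n}{\Gamma(\delta_3+\beta_4 n)},$$ $$D_2\left(\begin{matrix}\gamma_1,\alpha_1,\beta_1;\gamma_2,\alpha_2;\gamma_3,\beta_2;\\ \delta_1,\alpha_3;\delta_2,\beta_3;\delta_3,\alpha_4;\delta_4,\beta_4;\end{matrix}\left|\begin{matrix}x\\ y\end{matrix}\right.\right)=\sum_{m,n=0}^{\infty}\frac{(\gamma_1)_{\alpha_1 m+\beta_1 n}(\gamma_2)_{\alpha_2 m}(\gamma_3)_{\beta_2 n}}{\Gamma(\delta_1+\alpha_3 m)\Gamma(\delta_2+\beta_3 n)}\frac{x^m}{\Gamma(\delta_3+\alpha_4 m)}\frac{y^n}{\Gamma(\delta_4+\beta_4 n)}.$$ The functions are considered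 at arguments in the region of absolute convergence of their defining series. *)

(* Defs.v *)
From HB Require Import structures.
From mathcomp Require Import all_boot all_order all_algebra.
From mathcomp Require Import all_classical all_reals all_analysis.
From mathcomp Require Import complex.

Set Implicit Arguments.
Unset Strict Implicit.
Unset Printing Implicit Defensive.

Import Order.TTheory GRing.Theory Num.Theory.
Import numFieldNormedType.Exports.

Local Open Scope classical_set_scope.
Local Open Scope ring_scope.
Local Open Scope complex_scope.

Section ComplexAnalysis.
Variable R : realType.
Implicit Types (t : R) (z : R[i]).

(* Limit for the modulus topology, which numFieldNormedType puts on R[i]^o. *)
Definition climn (u : nat -> R[i]) : R[i] := limn (u : nat -> R[i]^o).

(* The principal power t ^ z = exp (z ln t) of a real number t > 0. *)
Definition cpow t z : R[i] :=
  (expR (complex.Re z * ln t))%:C *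
  (cos (complex.Im z * ln t) +i* sin (complex.Im z * ln t)).

(* Gauss' product formula
     Gamma z = lim_n n! n^z / (z (z + 1) ... (z + n)),
   which holds wherever Gamma is defined.  At a pole z = - k the terms with
   n >= k are 0 because 0^-1 = 0, so that Gamma z = 0 there; hence
   (Gamma z)^-1 is the entire function 1 / Gamma at every z. *)
Definition Gamma z : R[i] :=
  climn (fun n => (n`!)%:R * cpow n%:R z / \prod_(k < n.+1) (z + k%:R)).

Definition Gamma_pole z : Prop := exists k : nat, z = - k%:R.

(* The quotient Gamma (g + l) / Gamma g.  If both points are poles then l is a
   natural number and the singularity of w |-> Gamma (w + l) / Gamma w at
   w = g is removable; the limit value g (g + 1) ... (g + l - 1) is taken. *)
Definition pochhammer (g : R[i]) (l : R) : R[i] :=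
  if `[< Gamma_pole g /\ Gamma_pole (g + l%:C) >]
  then \prod_(k < Num.truncn l) (g + k%:R)
  else Gamma (g + l%:C) / Gamma g.

Definition abs_convergent2 (a : nat -> nat -> R[i]) : Prop :=
  summable [set: nat * nat] (fun p => (complex.Re `|a p.1 p.2|)%:E).

(* Sum of a double series, as the limit of its square partial sums; this is
   only used for absolutely convergent series, whose sum does not depend on the
   order of summation. *)
Definition dseries (a : nat -> nat -> R[i]) : R[i] :=
  climn (fun N => \sum_(m < N) \sum_(n < N) a m n).

Definition cintegrable (D : set R) (f : R -> R[i]) : Prop :=
  (@lebesgue_measure R).-integrable D (fun t => (complex.Re (f t))%:E) /\
  (@lebesgue_measure R).-integrable D (fun t => (complex.Im (f t))%:E).

Definition cintegral (D : set R) (f : R -> R[i]) : R[i] :=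
  Rintegral (@lebesgue_measure R) D (fun t => complex.Re (f t)) +i*
  Rintegral (@lebesgue_measure R) D (fun t => complex.Im (f t)).

End ComplexAnalysis.

(* The parameters of D1 and D2 are listed row by row, from left to right, as in
   the array notation for these functions. *)
Section DFunctions.
Variable R : realType.

Definition D1_term (gamma1 : R[i]) (alpha1 beta1 : R)
    (gamma2 : R[i]) (alpha2 : R) (gamma3 : R[i]) (beta2 : R)
    (delta1 : R[i]) (alpha3 beta3 : R)
    (delta2 : R[i]) (alpha4 : R) (delta3 : R[i]) (beta4 : R)
    (x y : R[i]) (m n : nat) : R[i] :=
  pochhammer gamma1 (alpha1 * m%:R + beta1 * n%:R) *
  pochhammer gamma2 (alpha2 * m%:R) * pochhammer gamma3 (beta2 * n%:R) /
  Gamma (delta1 + (alpha3 * m%:R + beta3 * n%:R)%:C) *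
  (x ^+ m / Gamma (delta2 + (alpha4 * m%:R)%:C)) *
  (y ^+ n / Gamma (delta3 + (beta4 * n%:R)%:C)).

Definition D1 gamma1 alpha1 beta1 gamma2 alpha2 gamma3 beta2
    delta1 alpha3 beta3 delta2 alpha4 delta3 beta4 x y : R[i] :=
  dseries (D1_term gamma1 alpha1 beta1 gamma2 alpha2 gamma3 beta2
    delta1 alpha3 beta3 delta2 alpha4 delta3 beta4 x y).

Definition D2_term (gamma1 : R[i]) (alpha1 beta1 : R)
    (gamma2 : R[i]) (alpha2 : R) (gamma3 : R[i]) (beta2 : R)
    (delta1 : R[i]) (alpha3 : R) (delta2 : R[i]) (beta3 : R)
    (delta3 : R[i]) (alpha4 : R) (delta4 : R[i]) (beta4 : R)
    (x y : R[i]) (m n : nat) : R[i] :=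
  pochhammer gamma1 (alpha1 * m%:R + beta1 * n%:R) *
  pochhammer gamma2 (alpha2 * m%:R) * pochhammer gamma3 (beta2 * n%:R) /
  (Gamma (delta1 + (alpha3 * m%:R)%:C) * Gamma (delta2 + (beta3 * n%:R)%:C)) *
  (x ^+ m / Gamma (delta3 + (alpha4 * m%:R)%:C)) *
  (y ^+ n / Gamma (delta4 + (beta4 * n%:R)%:C)).

Definition D2 gamma1 alpha1 beta1 gamma2 alpha2 gamma3 beta2
    delta1 alpha3 delta2 beta3 delta3 alpha4 delta4 beta4 x y : R[i] :=
  dseries (D2_term gamma1 alpha1 beta1 gamma2 alpha2 gamma3 beta2
    delta1 alpha3 delta2 beta3 delta3 alpha4 delta4 beta4 x y).

End DFunctions.

(* Main.v *)
Require Import Defs.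
From HB Require Import structures.
From mathcomp Require Import all_boot all_order all_algebra.
From mathcomp Require Import all_classical all_reals all_analysis.
From mathcomp Require Import measurable_realfun.
From mathcomp Require Import complex.
From mathcomp Require Import ring lra.
Import Order.TTheory GRing.Theory Num.Theory.
Import numFieldNormedType.Exports.
Import Normc.
Local Open Scope classical_set_scope.
Local Open Scope ring_scope.
Local Open Scope complex_scope.

(** Expanding the inner function into its series turns the integrand into
      sum_(m, n) c m n x^m y^n k(m, n)(t) / (Gamma (mu1 + alpha3 m) Gamma (mu2 + beta3 n)),
    where c m n collects the Pochhammer symbols and the remaining Gamma factors and
    k(m, n)(t) = t^(mu1 + alpha3 m - 1) (1 - t)^(mu2 + beta3 n - 1).  Euler's
    beta integral, [beta_Gamma], evaluates the integral of k(m, n) as the quotient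
    Gamma (mu1 + alpha3 m) Gamma (mu2 + beta3 n) / Gamma (mu1 + mu2 + alpha3 m + beta3 n),
    so that integration term by term produces the outer series.

    The interchange is dominated convergence ([cintegral_dseries]): the integrals
    of the absolute values of the terms must have a finite sum.  Replacing k(m, n)
    by its absolute value replaces mu1 and mu2 by their real parts, and the
    resulting beta integral is compared with the original one through two facts
    on Re z > 0: |Gamma z| <= Gamma (Re z) ([normc_Gamma_le]), and the quotient
    Gamma (Re z) / |Gamma z| decreases along horizontal half-lines
    ([Gamma_ratio_anti]).  Hence each such integral is at most a constant times the
    absolute value of the corresponding term of the outer series, which converges
    absolutely by hypothesis.

    On Re z > 0 the Gauss product converges to a nonzero limit ([gauss_cvg])
    because consecutive products have quotient 1 + O(1/n^2), and both facts on
    |Gamma| hold factor by factor.  The beta integral B(a, b) satisfies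
    a B(a, b) = (a + b) B(a + 1, b), by an integration by parts; n applications of
    this introduce Gauss products, and the remainder n^b B(a + n + 1, b) tends to
    Gamma b. *)

(** * Complex sequences *)

Section ComplexSequences.
Context {R : realType}.
Implicit Types (z w l : R[i]) (u v : nat -> R[i]) (r : R).

Lemma ReD z w : complex.Re (z + w) = complex.Re z + complex.Re w.
Proof. by case: z; case: w. Qed.

Lemma ImD z w : complex.Im (z + w) = complex.Im z + complex.Im w.
Proof. by case: z; case: w. Qed.

Lemma ReB z w : complex.Re (z - w) = complex.Re z - complex.Re w.
Proof. by case: z; case: w. Qed.

Lemma ImB z w : complex.Im (z - w) = complex.Im z - complex.Im w.
Proof. by case: z; case: w. Qed.

Lemma ReM z w : complex.Re (z * w) =
  complex.Re z * complex.Re w - complex.Im z * complex.Im w.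
Proof. by case: z; case: w. Qed.

Lemma ImM z w : complex.Im (z * w) =
  complex.Re z * complex.Im w + complex.Im z * complex.Re w.
Proof. by case: z; case: w. Qed.

Lemma Re_natr n : complex.Re (n%:R : R[i]) = n%:R.
Proof. by rewrite -(rmorph_nat (real_complex R)). Qed.

Lemma Re_addn z n : complex.Re (z + n%:R) = complex.Re z + n%:R.
Proof. by rewrite ReD Re_natr. Qed.

Lemma normC_normc z : `|z| = (normc z)%:C.
Proof. by case: z. Qed.

Lemma normc_ge0 z : 0 <= normc z.
Proof. by case: z => a b /=; exact: sqrtr_ge0. Qed.

Lemma ler_normcD z w : normc (z + w) <= normc z + normc w.
Proof. exact: (le_normcD (z : Rcomplex R) w). Qed.

Lemma normcNE z : normc (- z) = normc z.
Proof. exact: (normcN (z : Rcomplex R)). Qed.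

Lemma normc_eq0 z : (normc z == 0) = (z == 0).
Proof.
apply/eqP/eqP => [/eq0_normc//|->]; exact: normc0.
Qed.

Lemma normc_gt0 z : (0 < normc z) = (z != 0).
Proof. by rewrite lt_neqAle eq_sym normc_ge0 andbT normc_eq0. Qed.

Lemma normc_real r : normc r%:C = `|r|.
Proof. by rewrite /= expr0n addr0 sqrtr_sqr. Qed.

Lemma normr_Re_le z : `|complex.Re z| <= normc z.
Proof.
case: z => a b /=; rewrite -sqrtr_sqr ler_sqrt ?lerDl ?sqr_ge0//.
by rewrite addr_ge0 ?sqr_ge0.
Qed.

Lemma normr_Im_le z : `|complex.Im z| <= normc z.
Proof.
case: z => a b /=; rewrite -sqrtr_sqr ler_sqrt ?lerDr ?sqr_ge0//.
by rewrite addr_ge0 ?sqr_ge0.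
Qed.

Lemma normc_le_ReIm z : normc z <= `|complex.Re z| + `|complex.Im z|.
Proof.
case: z => a b /=; rewrite -[leRHS]ger0_norm ?addr_ge0//.
rewrite -sqrtr_sqr ler_sqrt ?sqr_ge0// sqrrD !real_normK ?num_real//.
by rewrite lerD2r lerDl mulrn_wge0// mulr_ge0.
Qed.

Lemma ler_normc_dist z w : `|normc z - normc w| <= normc (z - w).
Proof.
rewrite ler_norml; apply/andP; split.
  by rewrite lerNl opprB lerBlDl -(normcNE (z - w)) opprB
             -{1}(subrKC z w) ler_normcD.
by rewrite lerBlDl -{1}(subrKC w z) ler_normcD.
Qed.

Lemma normc_prod (I : Type) (s : seq I) (P : pred I) (F : I -> R[i]) :
  normc (\prod_(i <- s | P i) F i) = \prod_(i <- s | P i) normc (F i).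
Proof.
by elim/big_rec2: _ => [|i x y _ <-]; [exact: normc1 | rewrite normcM].
Qed.

Lemma ler_normc_sum (I : Type) (s : seq I) (P : pred I) (F : I -> R[i]) :
  normc (\sum_(i <- s | P i) F i) <= \sum_(i <- s | P i) normc (F i).
Proof.
elim/big_ind2 : _ => //; first by rewrite normc0.
by move=> x1 x2 y1 y2 h1 h2; rewrite (le_trans (ler_normcD _ _))// lerD.
Qed.

Lemma cvg_le_dist (a b : nat -> R) (c : R) :
  (forall n, `|a n - c| <= b n) -> b @ \oo --> (0 : R) -> a @ \oo --> c.
Proof.
move=> ab b0; have bl : (fun n => c - b n) @ \oo --> c.
  by rewrite -[X in _ --> X]subr0; apply: cvgB => //; exact: cvg_cst.
have br : (fun n => c + b n) @ \oo --> c.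
  by rewrite -[X in _ --> X]addr0; apply: cvgD => //; exact: cvg_cst.
apply: squeeze_cvgr bl br; apply: nearW => n.
by rewrite -ler_distl.
Qed.

(** Convergence for the modulus topology is convergence of the real sequence
    of distances, which makes the real limit theory available. *)
Lemma cvgCP u l : (u @ \oo --> (l : R[i]^o)) <->
  (fun n => normc (u n - l)) @ \oo --> (0 : R).
Proof.
split=> [h|h].
  move/(@cvgrPdist_lt _ R[i]^o) : h => h.
  apply/cvgrPdist_lt => e e0; have := h e%:C; rewrite ltcR => /(_ e0).
  apply: filterS => n; rewrite normC_normc ltcR sub0r normrN.
  by rewrite ger0_norm ?normc_ge0// -normcNE opprB.
apply/(@cvgrPdist_lt _ R[i]^o) => e e0.
have [e' e'E] : exists e' : R, e = e'%:C.
  by exists (complex.Re e); rewrite RRe_real// gtr0_real.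
move: e0; rewrite e'E ltcR => e0; 
have hn : \forall n \near \oo, `|0 - normc (u n - l)| < e' by exact: cvgr_dist_lt.
apply: filterS hn => n.
rewrite sub0r normrN ger0_norm ?normc_ge0// -normcNE opprB => hn.
by rewrite normC_normc ltcR.
Qed.

Lemma climn_eq u l : u @ \oo --> (l : R[i]^o) -> climn u = l.
Proof. by move=> ul; apply: (@cvg_lim R[i]^o _ nat) ul; exact: norm_hausdorff. Qed.

Lemma cvgC_normc u l : u @ \oo --> (l : R[i]^o) ->
  (fun n => normc (u n)) @ \oo --> normc l.
Proof.
move=> ul; have h := (cvgCP _ _).1 ul; apply: cvg_le_dist h => n.
by rewrite ler_normc_dist.
Qed.

Lemma cvgC_Re u l : u @ \oo --> (l : R[i]^o) ->
  (fun n => complex.Re (u n)) @ \oo --> complex.Re l.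
Proof.
move=> ul; have h := (cvgCP _ _).1 ul; apply: cvg_le_dist h => n.
by rewrite -ReB normr_Re_le.
Qed.

Lemma cvgC_Im u l : u @ \oo --> (l : R[i]^o) ->
  (fun n => complex.Im (u n)) @ \oo --> complex.Im l.
Proof.
move=> ul; have h := (cvgCP _ _).1 ul; apply: cvg_le_dist h => n.
by rewrite -ImB normr_Im_le.
Qed.

Lemma cvgC_ReIm u l : (fun n => complex.Re (u n)) @ \oo --> complex.Re l ->
  (fun n => complex.Im (u n)) @ \oo --> complex.Im l ->
  u @ \oo --> (l : R[i]^o).
Proof.
move=> hr hi; apply/cvgCP.
have h : (fun n => `|complex.Re (u n) - complex.Re l| +
                   `|complex.Im (u n) - complex.Im l|) @ \oo --> (0 : R).
  by rewrite -[0]addr0; apply: cvgD; apply/norm_cvg0P/subr_cvg0.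
apply: cvg_le_dist h => n.
by rewrite subr0 ger0_norm ?normc_ge0// -ReB -ImB normc_le_ReIm.
Qed.

Lemma cvgC_mul u v l w : u @ \oo --> (l : R[i]^o) -> v @ \oo --> (w : R[i]^o) ->
  (fun n => u n * v n) @ \oo --> (l * w : R[i]^o).
Proof.
move=> ul vw.
have [ur ui] := (cvgC_Re _ _ ul, cvgC_Im _ _ ul).
have [vr vi] := (cvgC_Re _ _ vw, cvgC_Im _ _ vw).
apply: cvgC_ReIm.
  by under eq_fun do rewrite ReM; rewrite ReM; apply: cvgB; exact: cvgM.
by under eq_fun do rewrite ImM; rewrite ImM; apply: cvgD; exact: cvgM.
Qed.

(** Adding V makes Re u and Im u nondecreasing, so that no appeal to Cauchy
    sequences in the complex plane is needed. *)
Lemma cvgC_dominated u (V : nat -> R) (M : R) :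
  (forall n, normc (u n.+1 - u n) <= V n.+1 - V n) -> (forall n, V n <= M) ->
  exists l, u @ \oo --> (l : R[i]^o).
Proof.
move=> hu hM.
have ndV : nondecreasing_seq V.
  apply/nondecreasing_seqP => n; rewrite -subr_ge0.
  exact: le_trans (normc_ge0 _) (hu n).
have cV : cvgn V.
  by apply: nondecreasing_is_cvgn => //; exists M => _ [n _ <-].
have key (f : nat -> R) : (forall n, `|f n.+1 - f n| <= V n.+1 - V n) -> cvgn f.
  move=> hf; suff cg : cvgn (f \+ V).
    have -> : f = (f \+ V) \- V by apply/funext => n /=; rewrite addrK.
    exact: is_cvgB.
  apply: nondecreasing_is_cvgn.
    apply/nondecreasing_seqP => n /=.
    by have := hf n; rewrite ler_norml => /andP[]; lra.
  exists (f 0%N - V 0%N + M + M) => _ [n _ <-] /=.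
  have : f n - V n <= f 0%N - V 0%N.
    elim: n => // n ih; have := hf n; rewrite ler_norml => /andP[]; lra.
  by have := hM n; lra.
have cr : cvgn (fun n => complex.Re (u n)).
  by apply: key => n; rewrite -ReB (le_trans (normr_Re_le _)).
have ci : cvgn (fun n => complex.Im (u n)).
  by apply: key => n; rewrite -ImB (le_trans (normr_Im_le _)).
by exists (limn (fun n => complex.Re (u n)) +i* limn (fun n => complex.Im (u n)));
  apply: cvgC_ReIm.
Qed.

(** An infinite product converges to a nonzero limit when its factors and
    their inverses differ from 1 by the terms of a convergent series. *)
Lemma cvgC_product u (V : nat -> R) (M : R) :
  (forall n, u n != 0) ->
  (forall n, normc (u n.+1 / u n - 1) <= V n.+1 - V n) ->
  (forall n, normc (u n / u n.+1 - 1) <= V n.+1 - V n) ->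
  (forall n, V n <= M) ->
  exists2 l, l != 0 & u @ \oo --> (l : R[i]^o).
Proof.
move=> u0 h1 h2 hM.
have bnd (v : nat -> R[i]) : (forall n, v n != 0) ->
    (forall n, normc (v n.+1 / v n - 1) <= V n.+1 - V n) ->
    forall n, normc (v n) <= normc (v 0%N) * expR (M - V 0%N).
  move=> v0 hv n.
  apply: (@le_trans _ _ (normc (v 0%N) * expR (V n - V 0%N))); last first.
    by rewrite ler_wpM2l ?normc_ge0// ler_expR lerD2r.
  elim: n => [|n ih]; first by rewrite subrr expR0 mulr1.
  have -> : v n.+1 = v n * (v n.+1 / v n) by rewrite mulrC divfK.
  rewrite normcM; have -> : V n.+1 - V 0%N = (V n - V 0%N) + (V n.+1 - V n) by ring.
  rewrite expRD mulrA ler_pM ?normc_ge0//.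
  apply: le_trans (expR_ge1Dx _); rewrite -[X in normc X](subrKC 1).
  by rewrite (le_trans (ler_normcD _ _))// normc1 lerD2l.
pose K := normc (u 0%N) * expR (M - V 0%N).
have K0 : 0 <= K by rewrite mulr_ge0 ?normc_ge0 ?expR_ge0.
have [||l ul] := @cvgC_dominated u (fun n => K * V n) (K * M).
- move=> n; rewrite -mulrBr.
  have -> : u n.+1 - u n = u n * (u n.+1 / u n - 1).
    by rewrite mulrBr mulr1 mulrCA mulfV// mulr1.
  by rewrite normcM ler_pM ?normc_ge0// bnd.
- by move=> n; rewrite ler_wpM2l.
exists l => //.
pose K' := normc (u 0%N)^-1 * expR (M - V 0%N).
have K'0 : 0 < K' by rewrite mulr_gt0 ?expR_gt0// normc_gt0 invr_neq0.
have hb n : K'^-1 <= normc (u n).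
  rewrite -[leRHS]invrK lef_pV2 ?posrE// ?invr_gt0 ?normc_gt0// -normcV.
  apply: (bnd (fun n => (u n)^-1)) => [m|m]; first by rewrite invr_neq0.
  by rewrite invrK mulrC.
rewrite -normc_gt0 (lt_le_trans (_ : 0 < K'^-1)) ?invr_gt0//.
have hl := cvgC_normc _ _ ul; rewrite -(cvg_lim _ hl)//.
apply: limr_ge; first by apply/cvg_ex; exists (normc l).
exact: nearW.
Qed.

End ComplexSequences.

(** * The complex exponential and Gauss' product *)

Section ComplexExponential.
Context {R : realType}.
Implicit Types (z w : R[i]) (r s t x : R).

Definition cexp z : R[i] :=
  (expR (complex.Re z))%:C * (cos (complex.Im z) +i* sin (complex.Im z)).

Lemma cpowE t z : cpow t z = cexp (z * (ln t)%:C).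
Proof. by rewrite /cpow /cexp; case: z => a b /=; rewrite !mulr0 subr0 add0r. Qed.

Lemma Re_cexp z : complex.Re (cexp z) = expR (complex.Re z) * cos (complex.Im z).
Proof. by rewrite /cexp /= mul0r subr0. Qed.

Lemma Im_cexp z : complex.Im (cexp z) = expR (complex.Re z) * sin (complex.Im z).
Proof. by rewrite /cexp /= mul0r addr0. Qed.

Lemma cexp_real r : cexp r%:C = (expR r)%:C.
Proof. by rewrite /cexp /= cos0 sin0 mulr1. Qed.

Arguments cexp : simpl never.

Lemma cexp0 : cexp 0 = 1.
Proof. by rewrite (cexp_real 0) expR0. Qed.

Lemma cexpD z w : cexp (z + w) = cexp z * cexp w.
Proof.
rewrite /cexp ReD ImD expRD cosD sinD; apply/eqP.
by rewrite eq_complex /=; apply/andP; split; apply/eqP; ring.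
Qed.

Lemma normc_cexp z : normc (cexp z) = expR (complex.Re z).
Proof.
rewrite /cexp normcM normc_real ger0_norm ?expR_ge0//=.
by rewrite cos2Dsin2 sqrtr1 mulr1.
Qed.

Lemma cexp_neq0 z : cexp z != 0.
Proof. by rewrite -normc_gt0 normc_cexp expR_gt0. Qed.

Lemma Re_mulr_real z r : complex.Re (z * r%:C) = complex.Re z * r.
Proof. by case: z => a b /=; rewrite mulr0 subr0. Qed.

Lemma Im_mulr_real z r : complex.Im (z * r%:C) = complex.Im z * r.
Proof. by case: z => a b /=; rewrite mulr0 add0r. Qed.

Lemma cpowD t z w : cpow t (z + w) = cpow t z * cpow t w.
Proof. by rewrite !cpowE mulrDl cexpD. Qed.

Lemma cpow0 t : cpow t 0 = 1.
Proof. by rewrite cpowE mul0r cexp0. Qed.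

Lemma cpow_neq0 t z : cpow t z != 0.
Proof. by rewrite cpowE cexp_neq0. Qed.

Lemma normc_cpow t z : normc (cpow t z) = expR (complex.Re z * ln t).
Proof. by rewrite cpowE normc_cexp Re_mulr_real. Qed.

Lemma cpow_real t r : cpow t r%:C = (expR (r * ln t))%:C.
Proof. by rewrite cpowE -rmorphM/= cexp_real. Qed.

Lemma cpow_nat t n : 0 < t -> cpow t n%:R = (t ^+ n)%:C.
Proof.
move=> t0; rewrite -(rmorph_nat (real_complex R)) /= cpow_real//.
by rewrite expRM_natl lnK// posrE.
Qed.

Lemma norm_sin_le x : `|sin x| <= `|x|.
Proof.
wlog x0 : x / 0 <= x.
  move=> h; have [/h//|/ltW] := leP 0 x; rewrite -oppr_ge0 => /h.
  by rewrite sinN !normrN.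
have [c _] := @MVT_segment _ sin cos 0 x x0
   (fun y _ => is_derive_sin y)
   (continuous_subspaceT (@continuous_sin R)).
by rewrite sin0 !subr0 => ->; rewrite normrM ler_piMl// cos_max.
Qed.

Lemma norm_cosB1_le x : `|cos x - 1| <= `|x|.
Proof.
wlog x0 : x / 0 <= x.
  move=> h; have [/h//|/ltW] := leP 0 x; rewrite -oppr_ge0 => /h.
  by rewrite cosN !normrN.
have [c _] := @MVT_segment _ cos (fun y => - sin y) 0 x x0
   (fun y _ => is_derive_cos y)
   (continuous_subspaceT (@continuous_cos R)).
by rewrite cos0 !subr0 => ->; rewrite normrM ler_piMl// normrN sin_max.
Qed.

Lemma norm_cosB1_le_sqr x : `|cos x - 1| <= x ^+ 2.
Proof.
wlog x0 : x / 0 <= x.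
  move=> h; have [/h//|/ltW] := leP 0 x; rewrite -oppr_ge0 => /h.
  by rewrite cosN sqrrN.
have [c] := @MVT_segment _ cos (fun y => - sin y) 0 x x0
   (fun y _ => is_derive_cos y)
   (continuous_subspaceT (@continuous_cos R)).
rewrite in_itv/= => /andP[c0 cx].
rewrite cos0 !subr0 => ->; rewrite normrM normrN (ger0_norm x0) expr2 ler_wpM2r//.
by rewrite (le_trans (norm_sin_le _))// ger0_norm.
Qed.

Lemma norm_sinB_le_sqr x : `|sin x - x| <= x ^+ 2.
Proof.
wlog x0 : x / 0 <= x.
  move=> h; have [/h//|/ltW] := leP 0 x; rewrite -oppr_ge0 => /h.
  by rewrite sinN -opprD normrN sqrrN.
have dB (y : R) : is_derive y 1 (fun s : R => sin s - s) (cos y - 1).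
  exact: is_deriveB.
have cB : continuous (fun s : R => sin s - s).
  by move=> y; apply: continuousB => //; exact: continuous_sin.
have [c] := @MVT_segment _ (fun y => sin y - y) (fun y => cos y - 1) 0 x x0
  (fun y _ => dB y) (continuous_subspaceT cB).
rewrite in_itv/= => /andP[c0 cx].
rewrite sin0 !subr0 => ->; rewrite normrM (ger0_norm x0) expr2 ler_wpM2r//.
by rewrite (le_trans (norm_cosB1_le _))// ger0_norm.
Qed.

Lemma expRB1_le r : 0 <= r -> expR r - 1 <= r * expR r.
Proof.
move=> r0; have := expR_ge1Dx (- r); rewrite expRN => h.
have e0 := expR_gt0 r.
have : (1 - r) * expR r <= 1.
  by rewrite -(ler_pM2r e0) in h; rewrite mulVf ?gt_eqF// in h.
lra.
Qed.

(** Second-order Taylor bound, with a constant that is uniform on a segment of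
    the ray through z. *)
Lemma cexp_taylor2 z : 0 <= complex.Re z -> exists2 C : R, 0 <= C &
  forall r, 0 <= r <= 1 ->
    normc (cexp (z * r%:C) - 1 - z * r%:C) <= C * r ^+ 2.
Proof.
set x := complex.Re z; set y := complex.Im z => x0.
exists (expR x * (x ^+ 2 + 2 * y ^+ 2 + `|y| * x)).
  by rewrite mulr_ge0 ?expR_ge0// !addr_ge0 ?sqr_ge0// mulr_ge0 ?sqr_ge0.
move=> r /andP[r0 r1].
apply: le_trans (normc_le_ReIm _) _.
rewrite !ReB !ImB Re_cexp Im_cexp Re_mulr_real Im_mulr_real /= -/x -/y subr0.
set p := x * r; set q := y * r.
have p0 : 0 <= p by rewrite mulr_ge0.
have E0 := expR_gt0 p.
have Ep : expR p <= expR x by rewrite ler_expR /p ler_piMr.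
have h1 := expRB1_le p p0.
have h2 : expR p - 1 - p <= p ^+ 2 * expR p.
  have : p * (expR p - 1) <= p * (p * expR p) by rewrite ler_wpM2l.
  by rewrite mulrA -expr2; lra.
have h3 := expR_ge1Dx p.
have A : `|expR p * cos q - 1 - p| <= expR p * q ^+ 2 + p ^+ 2 * expR p.
  have -> : expR p * cos q - 1 - p = expR p * (cos q - 1) + (expR p - 1 - p) by ring.
  rewrite (le_trans (ler_normD _ _))// lerD//.
    by rewrite normrM gtr0_norm// ler_wpM2l ?(ltW E0)// norm_cosB1_le_sqr.
  by rewrite ger0_norm//; lra.
have B : `|expR p * sin q - q| <= expR p * q ^+ 2 + `|q| * (p * expR p).
  have -> : expR p * sin q - q = expR p * (sin q - q) + q * (expR p - 1) by ring.
  rewrite (le_trans (ler_normD _ _))// lerD//.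
    by rewrite normrM gtr0_norm// ler_wpM2l ?(ltW E0)// norm_sinB_le_sqr.
  by rewrite normrM ler_wpM2l// ger0_norm//; lra.
apply: (le_trans (lerD A B)).
have -> : expR p * q ^+ 2 + p ^+ 2 * expR p + (expR p * q ^+ 2 + `|q| * (p * expR p))
   = expR p * ((x ^+ 2 + 2 * y ^+ 2 + `|y| * x) * r ^+ 2).
  by rewrite /q normrM (ger0_norm r0) /p; ring.
rewrite -mulrA ler_wpM2r// mulr_ge0 ?sqr_ge0//.
by rewrite !addr_ge0 ?sqr_ge0// mulr_ge0 ?sqr_ge0.
Qed.

End ComplexExponential.

Section GaussProduct.
Context {R : realType}.
Implicit Types (z w : R[i]).

Definition gauss z (n : nat) : R[i] :=
  (n`!)%:R * cpow n%:R z / \prod_(k < n.+1) (z + k%:R).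

Lemma addC_nat_neq0 z (k : nat) : 0 < complex.Re z -> z + k%:R != 0.
Proof.
move=> z0; apply/eqP => /(congr1 (@complex.Re R)); rewrite Re_addn.
by apply/eqP; rewrite gt_eqF// ltr_wpDr.
Qed.

Lemma prod_addC_neq0 z n : 0 < complex.Re z -> \prod_(k < n) (z + k%:R) != 0.
Proof. by move=> z0; apply/prodf_neq0 => k _; exact: addC_nat_neq0. Qed.

Lemma gauss_neq0 z n : 0 < complex.Re z -> gauss z n != 0.
Proof.
move=> z0; apply: mulf_neq0; last by rewrite invr_neq0// prod_addC_neq0.
by apply: mulf_neq0 (cpow_neq0 _ _); rewrite pnatr_eq0 -lt0n fact_gt0.
Qed.

(* The quotients are taken from index 1 on: at index 0 the Gauss product
   contains a power of 0, which is 1 by convention. *)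
Let h (n : nat) : R := n.+2%:R^-1.
Let L (n : nat) : R := ln n.+2%:R - ln n.+1%:R.

Lemma gaussS_ratio z n : 0 < complex.Re z ->
  gauss z n.+2 / gauss z n.+1 = cexp (z * (L n)%:C) / (1 + z * (h n)%:C).
Proof.
move=> z0; rewrite /gauss big_ord_recr /=.
set P := \prod_(_ < _) _.
have P0 : P != 0 by exact: prod_addC_neq0.
rewrite factS natrM !cpowE.
have f0 : (n.+1`!)%:R != 0 :> R[i] by rewrite pnatr_eq0 -lt0n fact_gt0.
have n0 : n.+2%:R != 0 :> R[i] by rewrite pnatr_eq0.
have zn : z + n.+2%:R != 0 by exact: addC_nat_neq0.
have -> : (h n)%:C = n.+2%:R^-1 by rewrite /h fmorphV/= rmorph_nat.
have -> : cexp (z * (ln n.+2%:R)%:C) =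
    cexp (z * (L n)%:C) * cexp (z * (ln n.+1%:R)%:C).
  by rewrite -cexpD -mulrDr -rmorphD/= subrK.
have e0 := cexp_neq0 (z * (ln n.+1%:R)%:C).
field.
have e2 : 2 + n%:R = n.+2%:R :> R[i] by rewrite -natrD.
by rewrite e2 [_ + z]addrC P0 zn n0 e0 f0.
Qed.

Lemma gauss_log_bounds n : [/\ h n <= L n, L n <= n.+1%:R^-1 & 0 <= h n].
Proof.
have n1 : 0 < n.+1%:R :> R by rewrite ltr0n.
have n2 : 0 < n.+2%:R :> R by rewrite ltr0n.
have e1 : n.+2%:R = 1 + n.+1%:R :> R by rewrite -natr1 addrC.
split; last by rewrite invr_ge0 ltW.
  have -> : L n = - ln (1 - h n).
    rewrite /L -opprB -ln_div ?posrE//; congr (- ln _).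
    rewrite /h e1; move: (n.+1%:R) n1 => a a0.
    by field; rewrite gt_eqF// addr_gt0.
  rewrite lerNr; apply: (@le_trans _ _ (ln (1 + - h n))) => //.
  by apply: le_ln1Dx; rewrite ltrN2 /h invf_lt1// ltr1n.
rewrite /L -ln_div ?posrE//.
have -> : n.+2%:R / n.+1%:R = 1 + n.+1%:R^-1 :> R
  by rewrite e1 mulrDl mul1r divff ?gt_eqF// addrC.
by apply: le_ln1Dx; rewrite (@lt_le_trans _ _ 0) ?invr_ge0 ?ltrN10// ltW.
Qed.

(** Consecutive Gauss products have quotient 1 + O(1/n^2): both the logarithm
    of (n+2)/(n+1) and the factor 1 + z/(n+2) agree with their first-order
    expansions up to that error. *)
Lemma gauss_cvg z : 0 < complex.Re z ->
  exists2 l : R[i], l != 0 & gauss z @ \oo --> (l : R[i]^o).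
Proof.
move=> z0; have [C C0 hC] := cexp_taylor2 z (ltW z0).
pose c := 2 * C + normc z.
have c0 : 0 <= c by rewrite addr_ge0 ?normc_ge0 ?mulr_ge0.
pose V n : R := - (c * n.+1%:R^-1).
have VE n : V n.+1 - V n = c * (n.+1%:R^-1 - n.+2%:R^-1) by rewrite /V; ring.
have main n : normc (cexp (z * (L n)%:C) - (1 + z * (h n)%:C)) <= V n.+1 - V n.
  have [hL Ln h0] := gauss_log_bounds n.
  have n1 : 0 < n.+1%:R :> R by rewrite ltr0n.
  have L0 : 0 <= L n := le_trans h0 hL.
  have L1 : L n <= 1 by rewrite (le_trans Ln)// invf_le1// ler1n.
  have -> : cexp (z * (L n)%:C) - (1 + z * (h n)%:C) =
     (cexp (z * (L n)%:C) - 1 - z * (L n)%:C) + z * (L n - h n)%:C.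
    have -> : (L n - h n)%:C = (L n)%:C - (h n)%:C by exact: rmorphB.
    by ring.
  rewrite VE /c mulrDl (le_trans (ler_normcD _ _))// lerD//.
    rewrite (le_trans (hC _ _)) ?L0 ?L1//.
    rewrite [2 * C]mulrC -mulrA ler_wpM2l//.
    apply: (@le_trans _ _ (n.+1%:R^-1 ^+ 2)); first by rewrite ler_sqr ?nnegrE ?invr_ge0// ltW.
    have n2 : 0 < n.+2%:R :> R by rewrite ltr0n.
    have e1 : n.+2%:R = n.+1%:R + 1 :> R by rewrite -natr1.
    have -> : n.+1%:R^-1 - n.+2%:R^-1 = n.+1%:R^-1 * n.+2%:R^-1 :> R.
      rewrite e1; move: (n.+1%:R) n1 => a a0.
      by field; rewrite !gt_eqF// addr_gt0.
    rewrite expr2 mulrCA ler_wpM2l ?invr_ge0 ?(ltW n1)//.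
    rewrite -[2 in leRHS]invrK -invfM lef_pV2 ?posrE ?mulr_gt0 ?invr_gt0//.
    rewrite e1; have : 1 <= n.+1%:R :> R by rewrite ler1n.
    lra.
  rewrite normcM normc_real ler_wpM2l ?normc_ge0//.
  by rewrite ger0_norm ?subr_ge0// lerD2r.
have den n : 1 <= normc (1 + z * (h n)%:C).
  have [_ _ h0] := gauss_log_bounds n.
  apply: le_trans (normr_Re_le _); rewrite ReD/= Re_mulr_real.
  by rewrite ger0_norm ?addr_ge0 ?lerDl ?mulr_ge0// ltW.
have num n : 1 <= normc (cexp (z * (L n)%:C)).
  have [hL _ h0] := gauss_log_bounds n.
  rewrite normc_cexp Re_mulr_real -expR0 ler_expR.
  by rewrite mulr_ge0 ?(ltW z0)// (le_trans h0).
have quot (a b : R[i]) (e : R) : normc (a - b) <= e -> 1 <= normc b -> normc (a / b - 1) <= e.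
  move=> ab b1; have b0 : b != 0 by rewrite -normc_gt0 (lt_le_trans ltr01).
  have -> : a / b - 1 = (a - b) / b by rewrite mulrBl divff.
  rewrite normcM normcV (le_trans _ ab)// ler_piMr ?normc_ge0//.
  by rewrite invf_le1// (lt_le_trans ltr01).
have [||||l l0 hl] := @cvgC_product _ (fun n => gauss z n.+1) V 0.
- by move=> n; exact: gauss_neq0.
- by move=> n; rewrite gaussS_ratio//; apply: quot.
- move=> n; rewrite -[X in normc (X - 1)]invf_div gaussS_ratio// invf_div.
  by apply: quot => //; rewrite -normcNE opprB.
- by move=> n; rewrite /V oppr_le0 mulr_ge0 ?invr_ge0.
exists l => //; by move: hl; rewrite (@cvg_shiftS R[i]^o (gauss z)).
Qed.

Lemma cvg_gauss z : 0 < complex.Re z -> gauss z @ \oo --> (Gamma z : R[i]^o).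
Proof.
move=> z0; have [l _ hl] := gauss_cvg z z0.
by have -> : Gamma z = l by exact: climn_eq.
Qed.

Lemma Gamma_neq0 z : 0 < complex.Re z -> Gamma z != 0.
Proof.
move=> z0; have [l l0 hl] := gauss_cvg z z0.
by have -> : Gamma z = l by exact: climn_eq.
Qed.

End GaussProduct.

(** * The modulus of the Gamma function *)

Section GammaModulus.
Context {R : realType}.
Implicit Types (z : R[i]) (s : R).

Lemma normc_addC_nat z (k : nat) : normc (z + k%:R) =
  Num.sqrt ((complex.Re z + k%:R) ^+ 2 + complex.Im z ^+ 2).
Proof.
have -> : z + k%:R = (complex.Re z + k%:R) +i* complex.Im z.
  rewrite -(rmorph_nat (real_complex R)); apply/eqP.
  by rewrite eq_complex ReD ImD /= addr0 !eqxx.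
by [].
Qed.

Lemma normc_gauss z n : normc (gauss z n.+1) =
  (n.+1`!)%:R * expR (complex.Re z * ln n.+1%:R) *
  \prod_(k < n.+2) (Num.sqrt ((complex.Re z + k%:R) ^+ 2 + complex.Im z ^+ 2))^-1.
Proof.
rewrite /gauss 2!normcM normcV normc_prod normc_cpow prodfV.
have nat_norm m : normc (m%:R : R[i]) = m%:R.
  by rewrite -(rmorph_nat (real_complex R)) normc_real normr_nat.
rewrite -[X in normc X * _]/((n.+1`!)%:R : R[i]) nat_norm.
by under eq_bigr do rewrite normc_addC_nat.
Qed.

Lemma normc_Gamma_le z : 0 < complex.Re z ->
  normc (Gamma z) <= normc (Gamma (complex.Re z)%:C).
Proof.
move=> z0.
have h1 := cvgC_normc _ _ (cvg_gauss z z0).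
have h2 := cvgC_normc _ _ (cvg_gauss (complex.Re z)%:C z0).
rewrite -(cvg_lim _ h1)// -(cvg_lim _ h2)//; apply: ler_lim.
- by apply/cvg_ex; eexists; exact: h1.
- by apply/cvg_ex; eexists; exact: h2.
exists 1%N => // -[//|n] _; rewrite !normc_gauss /= ler_wpM2l ?mulr_ge0 ?expR_ge0//.
apply: ler_prod => k _; rewrite invr_ge0 sqrtr_ge0/=.
have zk : 0 < complex.Re z + k%:R by rewrite ltr_wpDr.
rewrite lef_pV2 ?posrE ?sqrtr_gt0 ?ltr_wpDr ?sqr_ge0 ?exprn_gt0//.
by rewrite ler_sqrt ?addr_ge0 ?sqr_ge0// lerD2l expr0n/= sqr_ge0.
Qed.

(** Termwise, the Gauss products give
    Gamma (Re z)^2 / |Gamma z|^2 = prod_k (1 + (Im z)^2 / (Re z + k)^2),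
    a decreasing function of Re z for a fixed Im z. *)
Lemma Gamma_ratio_anti z s : 0 < complex.Re z -> 0 <= s ->
  normc (Gamma (complex.Re z + s)%:C) * normc (Gamma z) <=
  normc (Gamma (complex.Re z)%:C) * normc (Gamma (z + s%:C)).
Proof.
move=> z0 s0.
have zs0 : 0 < complex.Re z + s by rewrite ltr_wpDr.
have zs0' : 0 < complex.Re (z + s%:C) by rewrite ReD.
have h1 : (fun n => normc (gauss (complex.Re z + s)%:C n) * normc (gauss z n)) @ \oo -->
    normc (Gamma (complex.Re z + s)%:C) * normc (Gamma z).
  by apply: cvgM; apply: cvgC_normc; exact: cvg_gauss.
have h2 : (fun n => normc (gauss (complex.Re z)%:C n) * normc (gauss (z + s%:C) n)) @ \oo -->
    normc (Gamma (complex.Re z)%:C) * normc (Gamma (z + s%:C)).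
  by apply: cvgM; apply: cvgC_normc; exact: cvg_gauss.
rewrite -(cvg_lim _ h1)// -(cvg_lim _ h2)//; apply: ler_lim.
- by apply/cvg_ex; eexists; exact: h1.
- by apply/cvg_ex; eexists; exact: h2.
exists 1%N => // -[//|n] _.
rewrite !normc_gauss ReD ImD /= addr0.
set x := complex.Re z; set y := complex.Im z.
rewrite mulrACA [leRHS]mulrACA -!big_split/=.
have -> : n.+1`!%:R * expR ((x + s) * ln n.+1%:R) * (n.+1`!%:R * expR (x * ln n.+1%:R)) =
  n.+1`!%:R * expR (x * ln n.+1%:R) * (n.+1`!%:R * expR ((x + s) * ln n.+1%:R)) :> R by ring.
apply: ler_wpM2l; first by rewrite !mulr_ge0 ?expR_ge0.
apply: ler_prod => k _; rewrite mulr_ge0 ?invr_ge0 ?sqrtr_ge0//=.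
have X0 : 0 < x + k%:R by rewrite ltr_wpDr.
have -> : x + s + k%:R = x + k%:R + s by ring.
move: (x + k%:R) X0 => X X0; rewrite expr0n/= addr0 addr0.
have Xs0 : 0 < X + s by rewrite ltr_wpDr.
have p t : 0 < t -> 0 < t ^+ 2 + y ^+ 2 by move=> t0; rewrite ltr_wpDr ?sqr_ge0 ?exprn_gt0.
rewrite -!invfM lef_pV2 ?posrE ?mulr_gt0 ?sqrtr_gt0 ?p ?exprn_gt0//.
rewrite -!sqrtrM ?sqr_ge0// ler_sqrt; last by rewrite mulr_ge0 ?sqr_ge0// ltW// p.
(* What remains is X^2 y^2 <= (X + s)^2 y^2. *)
rewrite !mulrDr [leRHS]addrC mulrC [leRHS]addrC lerD2l ler_wpM2r ?sqr_ge0//.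
by rewrite ler_sqr ?nnegrE ?lerDl// ltW.
Qed.

End GammaModulus.

(** * Improper integrals on the unit interval *)

Section ImproperIntegral.
Context {R : realType}.
Notation mu := (@lebesgue_measure R).
Implicit Types (f F : R -> R).

(** Offset of the compact segments that exhaust the open unit interval; with
    denominators at least 3 they are never degenerate. *)
Definition inset (n : nat) : R := n.+3%:R^-1.
Local Notation D n := (`[inset n, 1 - inset n]%classic : set R).
Local Notation I01 := (`]0, 1[%classic : set R).

Lemma inset_bounds n : 0 < inset n < 1 - inset n.
Proof.
have n0 : 0 < n.+3%:R :> R by rewrite ltr0n.
rewrite invr_gt0 n0 /=.
have : inset n * n.+3%:R = 1 by rewrite mulVf// gt_eqF.
have i0 : 0 < inset n by rewrite invr_gt0.
have : inset n * 3 <= inset n * n.+3%:R by rewrite ler_wpM2l ?(ltW i0)// ler_nat.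
lra.
Qed.

Lemma inset_cvg0 : inset @ \oo --> (0 : R).
Proof.
have -> : inset = (fun n => harmonic (n + 2)%N) by apply/funext => n; rewrite addn2.
by rewrite (cvg_shiftn 2); exact: cvg_harmonic.
Qed.

Lemma near_inset x : I01 x -> \forall n \near \oo, D n x.
Proof.
rewrite /= in_itv/= => /andP[x0 x1].
have x1' : 0 < 1 - x by rewrite subr_gt0.
near=> n; rewrite /= in_itv/= lerBrDl -lerBrDr; apply/andP; split.
  near: n; exact: (cvgr_le _ inset_cvg0 _ x0).
near: n; exact: (cvgr_le _ inset_cvg0 _ x1').
Unshelve. all: by end_near. Qed.

Lemma D_sub_I01 n : D n `<=` I01.
Proof.
have /andP[i0 i1] := inset_bounds n.
move=> x; rewrite /= !in_itv/= => /andP[h1 h2].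
by rewrite (lt_le_trans i0)// (le_lt_trans h2)// ltrBlDr ltrDl.
Qed.

Lemma patch_inset_cvg (f : R -> \bar R) x : I01 x ->
  (f \_ (D n)) x @[n --> \oo] --> f x.
Proof.
move=> xI; apply: cvg_near_cst; have := near_inset x xI.
by apply: filterS => n Dn; rewrite patchE mem_set.
Qed.

Lemma integral_patch_inset (f : R -> \bar R) n :
  (\int[mu]_(x in I01) (f \_ (D n)) x = \int[mu]_(x in D n) f x)%E.
Proof. by rewrite -integral_mkcondr setIidr//; exact: D_sub_I01. Qed.

Lemma measurable_patch_inset (f : R -> \bar R) n : measurable_fun I01 f ->
  measurable_fun I01 (f \_ (D n)).
Proof.
move=> mf; apply/measurable_restrict => //.
by apply: measurable_funS mf => //; exact: subIsetl.
Qed.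

Lemma cvg_integral_inset f : mu.-integrable I01 (EFin \o f) ->
  (\int[mu]_(x in D n) (f x)%:E)%E @[n --> \oo] --> (\int[mu]_(x in I01) (f x)%:E)%E.
Proof.
move=> intf; have mf := measurable_int _ intf.
have mI : measurable (I01 : set (measurableTypeR R)) by [].
have -> : (fun n => \int[mu]_(x in D n) (f x)%:E)%E =
    (fun n => \int[mu]_(x in I01) ((EFin \o f) \_ (D n)) x)%E.
  by apply/funext => n; rewrite integral_patch_inset.
apply: (@dominated_cvg _ _ _ mu _ mI (fun n => (EFin \o f) \_ (D n))
  (EFin \o f) (abse \o (EFin \o f))) => //.
- by move=> n; exact: measurable_patch_inset.
- by move=> x xI; exact: (patch_inset_cvg (EFin \o f)).
- exact: integrable_abse.
- by move=> n x xI; rewrite patchE; case: ifPn => // _; rewrite /= normr0 lee_fin normr_ge0.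
Qed.

Lemma FTC_inset f F n :
  (forall x, 0 < x < 1 -> {for x, continuous f}) ->
  (forall x : R, 0 < x < 1 -> is_derive x 1 F (f x)) ->
  (\int[mu]_(x in D n) (f x)%:E = (F (1 - inset n) - F (inset n))%:E)%E.
Proof.
move=> cf dF; have /andP[i0 i1] := inset_bounds n.
have sub x : inset n <= x <= 1 - inset n -> 0 < x < 1.
  by move=> /andP[h1 h2]; rewrite (lt_le_trans i0)// (le_lt_trans h2)// ltrBlDr ltrDl.
have cF x : 0 < x < 1 -> {for x, continuous F}.
  move=> /dF dFx; apply/differentiable_continuous/derivable1_diffP.
  exact: ex_derive.
rewrite (@continuous_FTC2 _ f F)// ?EFinB//.
- by apply: continuous_in_subspaceT => x; rewrite inE/= in_itv/= => /sub; exact: cf.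
- split.
  + move=> x; rewrite in_itv/= => /andP[h1 h2]; 
    have x01 : 0 < x < 1 by apply: sub; rewrite !ltW.
    by have dFx := dF x x01; exact: ex_derive.
  + by apply: cvg_at_right_filter; apply: cF; apply: sub; rewrite lexx ltW.
  + by apply: cvg_at_left_filter; apply: cF; apply: sub; rewrite lexx ltW.
- move=> x; rewrite in_itv/= => /andP[h1 h2]; rewrite derive1E.
  have x01 : 0 < x < 1 by apply: sub; rewrite !ltW.
  by have dFx := dF x x01; exact: derive_val.
Qed.

Lemma measurable_continuous01 f : (forall x, 0 < x < 1 -> {for x, continuous f}) ->
  measurable_fun I01 f.
Proof.
move=> cf; apply: open_continuous_measurable_fun; first exact: interval_open.
by move=> x; rewrite inE/= in_itv/=; exact: cf.
Qed.

(** Monotone convergence along the compact segments that exhaust the open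
    interval, on which the fundamental theorem of calculus applies. *)
Lemma integrable_bounded_antiderivative f F (M : R) :
  (forall x, 0 < x < 1 -> 0 <= f x) ->
  (forall x, 0 < x < 1 -> {for x, continuous f}) ->
  (forall x : R, 0 < x < 1 -> is_derive x 1 F (f x)) ->
  (forall x, 0 < x < 1 -> `|F x| <= M) ->
  mu.-integrable I01 (EFin \o f).
Proof.
move=> f0 cf dF FM.
have mI : measurable (I01 : set (measurableTypeR R)) by [].
have mf : measurable_fun I01 (EFin \o f).
  by apply/measurable_EFinP; exact: measurable_continuous01.
have f0' x : I01 x -> (0 <= (f x)%:E)%E.
  by rewrite /= in_itv/= => /f0; rewrite lee_fin.
have ndD x : {homo (fun n => ((EFin \o f) \_ (D n)) x) : n m / (n <= m)%N >-> (n <= m)%E}.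
  move=> n m nm; rewrite !patchE; case: ifPn => xn.
    have xn' : D n x by rewrite -inE.
    rewrite mem_set//; move: xn'; rewrite /= !in_itv/= => /andP[h1 h2].
    have im : inset m <= inset n by rewrite /inset lef_pV2 ?posrE ?ltr0n// ler_nat.
    by rewrite (le_trans im)//= (le_trans h2)// lerD2l lerN2.
  case: ifPn => // xm; apply: f0'; apply: (@D_sub_I01 m); by rewrite -inE.
apply/integrableP; split => //.
have -> : (\int[mu]_(x in I01) `|(EFin \o f) x| = \int[mu]_(x in I01) (f x)%:E)%E.
  by apply: eq_integral => x; rewrite inE => xI; rewrite gee0_abs// f0'.
have -> : (\int[mu]_(x in I01) (f x)%:E =
   \int[mu]_(x in I01) limn (fun n => ((EFin \o f) \_ (D n)) x))%E.
  apply: eq_integral => x; rewrite inE => xI.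
  by apply/esym/cvg_lim => //; exact: (patch_inset_cvg (EFin \o f)).
rewrite monotone_convergence//; last 2 first.
- by move=> n; exact: measurable_patch_inset.
- move=> n x xI; rewrite patchE; case: ifPn => // _; exact: f0'.
apply: (@le_lt_trans _ _ (M + M)%:E); last exact: ltry.
apply: lime_le.
  apply: ereal_nondecreasing_is_cvgn => n m nm.
  apply: ge0_le_integral => //.
  - move=> x xI; rewrite patchE; case: ifPn => // _; exact: f0'.
  - exact: measurable_patch_inset.
  - exact: measurable_patch_inset.
  - by move=> x xI; exact: ndD.
apply: nearW => n; rewrite integral_patch_inset (FTC_inset f F)// lee_fin.
have /andP[i0 i1] := inset_bounds n.
rewrite (le_trans (ler_norm _))// (le_trans (ler_normB _ _))// lerD// FM//.
  by rewrite (lt_trans i0)//= ltrBlDr ltrDl.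
by rewrite i0/= (lt_trans i1)// ltrBlDr ltrDl.
Qed.

Lemma improper_FTC f F (A B : R) :
  (forall x, 0 < x < 1 -> {for x, continuous f}) ->
  (forall x : R, 0 < x < 1 -> is_derive x 1 F (f x)) ->
  mu.-integrable I01 (EFin \o f) ->
  (fun n => F (inset n)) @ \oo --> A ->
  (fun n => F (1 - inset n)) @ \oo --> B ->
  Rintegral mu I01 f = B - A.
Proof.
move=> cf dF intf FA FB.
have mI : measurable (I01 : set (measurableTypeR R)) by [].
have h := cvg_integral_inset f intf.
rewrite /Rintegral.
have e : (\int[mu]_(x in I01) (f x)%:E)%E \is a fin_num.
  exact: (@integrable_fin_num _ _ _ mu _ mI (EFin \o f) intf).
have h1 : (fun n => F (1 - inset n) - F (inset n)) @ \oo -->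
   fine (\int[mu]_(x in I01) (f x)%:E)%E.
  have -> : (fun n => F (1 - inset n) - F (inset n)) =
      (fun n => fine (\int[mu]_(x in D n) (f x)%:E)%E).
    by apply/funext => n; rewrite (FTC_inset f F).
  by apply: fine_cvg; rewrite fineK.
have h2 : (fun n => F (1 - inset n) - F (inset n)) @ \oo --> B - A.
  exact: cvgB.
exact: (cvg_unique _ h1 h2).
Qed.

End ImproperIntegral.

(** * Complex-valued integrals *)

Section ComplexIntegral.
Context {R : realType}.
Notation mu := (@lebesgue_measure R).
Implicit Types (f g F : R -> R[i]) (c A B : R[i]).
Local Notation I01 := (`]0, 1[%classic : set R).

Lemma eq_cintegrable f g : (forall t, 0 < t < 1 -> f t = g t) ->
  cintegrable I01 f -> cintegrable I01 g.
Proof.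
move=> fg [h1 h2]; split; [apply: eq_integrable h1|apply: eq_integrable h2] => //;
  by move=> t; rewrite inE/= in_itv/= => /fg ->.
Qed.

Lemma eq_cintegral f g : (forall t, 0 < t < 1 -> f t = g t) ->
  cintegral I01 f = cintegral I01 g.
Proof.
by move=> fg; congr (_ +i* _); apply: eq_Rintegral => t;
  rewrite inE/= in_itv/= => /fg ->.
Qed.

Lemma cintegrableD f g : cintegrable I01 f -> cintegrable I01 g ->
  cintegrable I01 (fun t => f t + g t) /\
  cintegral I01 (fun t => f t + g t) = cintegral I01 f + cintegral I01 g.
Proof.
move=> [f1 f2] [g1 g2]; have mI : measurable (I01 : set (measurableTypeR R)) by [].
split; [split|].
- apply: eq_integrable (integrableD mI f1 g1) => // t _.
  by rewrite ReD EFinD.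
- apply: eq_integrable (integrableD mI f2 g2) => // t _.
  by rewrite ImD EFinD.
- rewrite /cintegral; apply/eqP; rewrite eq_complex /=; apply/andP; split; apply/eqP.
    by rewrite -(RintegralD mI f1 g1); apply: eq_Rintegral => t _; rewrite ReD.
  by rewrite -(RintegralD mI f2 g2); apply: eq_Rintegral => t _; rewrite ImD.
Qed.

Lemma cintegrableZ c f : cintegrable I01 f ->
  cintegrable I01 (fun t => c * f t) /\
  cintegral I01 (fun t => c * f t) = c * cintegral I01 f.
Proof.
move=> [f1 f2]; have mI : measurable (I01 : set (measurableTypeR R)) by [].
case: c => c d.
have reE t : complex.Re ((c +i* d) * f t) = c * complex.Re (f t) + (- d) * complex.Im (f t).
  by case: (f t) => x y /=; rewrite mulNr.
have imE t : complex.Im ((c +i* d) * f t) = c * complex.Im (f t) + d * complex.Re (f t).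
  by case: (f t).
have iZ (k : R) (h : R -> R) : mu.-integrable I01 (fun t => (h t)%:E) ->
    mu.-integrable I01 (fun t => (k * h t)%:E).
  move=> hi; exact: eq_integrable (integrableZl mI k hi).
have rZ (k : R) (h : R -> R) : mu.-integrable I01 (fun t => (h t)%:E) ->
    Rintegral mu I01 (fun t => k * h t) = k * Rintegral mu I01 h.
  by move=> hi; exact (@RintegralZl _ _ _ mu I01 h k mI hi).
split; [split|].
- apply: eq_integrable (integrableD mI (iZ c _ f1) (iZ (- d) _ f2)) => // t _.
  by rewrite reE EFinD.
- apply: eq_integrable (integrableD mI (iZ c _ f2) (iZ d _ f1)) => // t _.
  by rewrite imE EFinD.
- rewrite /cintegral; apply/eqP; rewrite eq_complex /=; apply/andP; split; apply/eqP.
    rewrite -mulNr -!rZ// -(RintegralD mI (iZ c _ f1) (iZ (- d) _ f2)).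
    by apply: eq_Rintegral => t _; rewrite reE.
  rewrite -!rZ// -(RintegralD mI (iZ c _ f2) (iZ d _ f1)).
  by apply: eq_Rintegral => t _; rewrite imE.
Qed.

Lemma cintegrable0 : cintegrable I01 (fun=> 0) /\ cintegral I01 (fun=> 0) = 0.
Proof.
have z : mu.-integrable I01 (fun=> (0 : R)%:E) by exact: integrable0.
split; first by split.
have h : Rintegral mu I01 (fun=> (0 : R)) = 0.
  by rewrite /Rintegral integral0.
by rewrite /cintegral /= h.
Qed.

Lemma cintegral_sum (n : nat) (f : nat -> R -> R[i]) :
  (forall i, cintegrable I01 (f i)) ->
  cintegrable I01 (fun t => \sum_(i < n) f i t) /\
  cintegral I01 (fun t => \sum_(i < n) f i t) = \sum_(i < n) cintegral I01 (f i).
Proof.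
move=> fi; elim: n => [|n [ih1 ih2]].
  have [h1 h2] := cintegrable0.
  have e : (fun t => \sum_(i < 0) f i t) = (fun=> 0) by apply/funext => t; rewrite big_ord0.
  by rewrite e big_ord0.
have e : (fun t => \sum_(i < n.+1) f i t) = (fun t => \sum_(i < n) f i t + f n t).
  by apply/funext => t; rewrite big_ord_recr.
by rewrite e big_ord_recr/= -ih2; exact: cintegrableD.
Qed.

(** The constant 2, instead of the sharp 1, spares the rotation argument. *)
Lemma normc_cintegral_le f (g : R -> R) : cintegrable I01 f ->
  mu.-integrable I01 (EFin \o g) ->
  (forall t, 0 < t < 1 -> normc (f t) <= g t) ->
  normc (cintegral I01 f) <= 2 * Rintegral mu I01 g.
Proof.
move=> [f1 f2] ig fg; have mI : measurable (I01 : set (measurableTypeR R)) by [].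
have key (h : R -> R) : mu.-integrable I01 (EFin \o h) ->
    (forall t, 0 < t < 1 -> `|h t| <= g t) -> `|Rintegral mu I01 h| <= Rintegral mu I01 g.
  move=> ih hg; apply: (le_trans (le_normr_Rintegral mI ih)).
  apply: (le_Rintegral mI) => //; exact: integrable_norm.
apply: (le_trans (normc_le_ReIm _)); rewrite mulr_natl mulr2n /=.
apply: lerD; apply: key => // t t01.
  by rewrite (le_trans (normr_Re_le _))// fg.
by rewrite (le_trans (normr_Im_le _))// fg.
Qed.

Definition ccontinuous01 f := forall t, 0 < t < 1 ->
  {for t, continuous (fun s => complex.Re (f s))} /\
  {for t, continuous (fun s => complex.Im (f s))}.

Definition cderivative01 F f := forall t : R, 0 < t < 1 ->
  is_derive t 1 (fun s => complex.Re (F s)) (complex.Re (f t)) /\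
  is_derive t 1 (fun s => complex.Im (F s)) (complex.Im (f t)).

Lemma cderivative_continuous F f : cderivative01 F f -> ccontinuous01 F.
Proof.
move=> Ff t /Ff [h1 h2].
by split; apply/differentiable_continuous/derivable1_diffP; exact: ex_derive.
Qed.

Lemma ccontinuousZ c f : ccontinuous01 f -> ccontinuous01 (fun t => c * f t).
Proof.
move=> cf t /cf [h1 h2]; case: c => c d; split.
  have -> : (fun s => complex.Re ((c +i* d) * f s)) =
      (fun s => c * complex.Re (f s) - d * complex.Im (f s)).
    by apply/funext => s; case: (f s).
  by apply: continuousB; apply: continuousM => //; exact: cst_continuous.
have -> : (fun s => complex.Im ((c +i* d) * f s)) =
    (fun s => c * complex.Im (f s) + d * complex.Re (f s)).
  by apply/funext => s; case: (f s).
by apply: continuousD; apply: continuousM => //; exact: cst_continuous.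
Qed.

Lemma ccontinuousB f g : ccontinuous01 f -> ccontinuous01 g ->
  ccontinuous01 (fun t => f t - g t).
Proof.
move=> cf cg t t01; have [h1 h2] := cf t t01; have [h3 h4] := cg t t01; split.
  have -> : (fun s => complex.Re (f s - g s)) =
      (fun s => complex.Re (f s) - complex.Re (g s)) by apply/funext => s; rewrite ReB.
  exact: continuousB.
have -> : (fun s => complex.Im (f s - g s)) =
    (fun s => complex.Im (f s) - complex.Im (g s)) by apply/funext => s; rewrite ImB.
exact: continuousB.
Qed.

Lemma ccontinuous_integrable f (g : R -> R) : ccontinuous01 f ->
  mu.-integrable I01 (EFin \o g) ->
  (forall t, 0 < t < 1 -> normc (f t) <= g t) ->
  cintegrable I01 f.
Proof.
move=> cf ig fg; have mI : measurable (I01 : set (measurableTypeR R)) by [].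
split; apply: (le_integrable mI _ _ ig).
- apply/measurable_EFinP; apply: measurable_continuous01 => t t01.
  by have [] := cf t t01.
- move=> t; rewrite /= in_itv/= => t01; rewrite lee_fin.
  by rewrite (le_trans (normr_Re_le _))// (le_trans (fg t t01))// ler_norm.
- apply/measurable_EFinP; apply: measurable_continuous01 => t t01.
  by have [] := cf t t01.
- move=> t; rewrite /= in_itv/= => t01; rewrite lee_fin.
  by rewrite (le_trans (normr_Im_le _))// (le_trans (fg t t01))// ler_norm.
Qed.

Lemma complex_improper_FTC f F A B : ccontinuous01 f -> cderivative01 F f ->
  cintegrable I01 f ->
  (fun n => F (inset n)) @ \oo --> (A : R[i]^o) ->
  (fun n => F (1 - inset n)) @ \oo --> (B : R[i]^o) ->
  cintegral I01 f = B - A.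
Proof.
move=> cf dF [i1 i2] FA FB; apply/eqP; rewrite eq_complex ReB ImB /=.
apply/andP; split; apply/eqP.
  apply: (improper_FTC _ (fun t => complex.Re (F t))) => //.
  - by move=> t /cf[].
  - by move=> t /dF[].
  - exact: cvgC_Re FA.
  - exact: cvgC_Re FB.
apply: (improper_FTC _ (fun t => complex.Im (F t))) => //.
- by move=> t /cf[].
- by move=> t /dF[].
- exact: cvgC_Im FA.
- exact: cvgC_Im FB.
Qed.

End ComplexIntegral.

(** * The beta kernel *)

Section BetaKernel.
Context {R : realType}.
Notation mu := (@lebesgue_measure R).
Implicit Types (a b : R[i]) (t p q : R).
Local Notation I01 := (`]0, 1[%classic : set R).

Lemma in01P t : 0 < t < 1 -> 0 < t /\ 0 < 1 - t.
Proof. by move=> /andP[t0 t1]; rewrite subr_gt0. Qed.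

Definition bpow a b t : R[i] := cpow t a * cpow (1 - t) b.

Definition bker a b t : R[i] := bpow (a - 1) (b - 1) t.

Definition rker p q t : R := expR ((p - 1) * ln t) * expR ((q - 1) * ln (1 - t)).

Lemma normc_bpow a b t : normc (bpow a b t) =
  expR (complex.Re a * ln t) * expR (complex.Re b * ln (1 - t)).
Proof. by rewrite /bpow normcM !normc_cpow. Qed.

Lemma normc_bker a b t :
  normc (bker a b t) = rker (complex.Re a) (complex.Re b) t.
Proof. by rewrite /bker normc_bpow !ReB. Qed.

Lemma bker_real p q t : bker p%:C q%:C t = (rker p q t)%:C.
Proof.
have e (r : R) : r%:C - 1 = (r - 1)%:C by rewrite rmorphB rmorph1.
by rewrite /bker /bpow !e !cpow_real -rmorphM.
Qed.

Lemma rker_ge0 p q t : 0 <= rker p q t.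
Proof. by rewrite mulr_ge0 ?expR_ge0. Qed.

Lemma cpow_sub1 a t : 0 < t -> cpow t (a - 1) = cpow t a * (t^-1)%:C.
Proof.
move=> t0; rewrite cpowD; congr (_ * _).
have -> : -1 = (-1 : R)%:C by rewrite rmorphN rmorph1.
by rewrite cpow_real// mulN1r expRN lnK.
Qed.

Lemma cpow_add1 a t : 0 < t -> cpow t (a + 1) = cpow t a * t%:C.
Proof. by move=> t0; rewrite cpowD (cpow_nat _ 1)// expr1. Qed.

Lemma is_derive_log2 p q t : 0 < t < 1 ->
  is_derive t 1 (fun s : R => p * ln s + q * ln (1 - s)) (p * t^-1 - q * (1 - t)^-1).
Proof.
move=> /in01P[t0 t1].
have d1 : is_derive t 1 (fun s : R => p * ln s) (p * t^-1).
  exact: (is_deriveZ p (is_derive1_ln t0)).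
have d0 : is_derive t 1 (fun s : R => 1 - s) (-1).
  have := @is_deriveB _ _ _ (cst 1 : R -> R) id t 1 0 1 _ _.
  by rewrite sub0r; exact.
have d2 : is_derive t 1 (fun s : R => q * ln (1 - s)) (- (q * (1 - t)^-1)).
  have h : is_derive t 1 ((@ln R) \o (fun s : R => 1 - s)) ((1 - t)^-1 * -1).
    by apply: is_derive1_comp; exact: is_derive1_ln.
  have h2 : is_derive t 1 (fun s : R => q * ln (1 - s)) (q * ((1 - t)^-1 * -1)).
    exact: (is_deriveZ q h).
  by apply: is_derive_eq h2 _; rewrite mulrN1 mulrN.
exact: is_deriveD.
Qed.

Lemma bpow_cexp a b t : bpow a b t = cexp (a * (ln t)%:C + b * (ln (1 - t))%:C).
Proof. by rewrite /bpow !cpowE cexpD. Qed.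

(** t^a (1 - t)^b is exp (a ln t + b ln (1 - t)), whose real and imaginary parts
    are differentiated separately. *)
Lemma is_derive_bpow a b :
  cderivative01 (bpow a b) (fun t => a * bker a (b + 1) t - b * bker (a + 1) b t).
Proof.
move=> t t01; have /in01P[t0 t1] := t01.
pose P s := complex.Re a * ln s + complex.Re b * ln (1 - s).
pose Q s := complex.Im a * ln s + complex.Im b * ln (1 - s).
have dP := is_derive_log2 (complex.Re a) (complex.Re b) t t01.
have dQ := is_derive_log2 (complex.Im a) (complex.Im b) t t01.
have reE : (fun s => complex.Re (bpow a b s)) = (fun s => expR (P s) * cos (Q s)).
  by apply/funext => s; rewrite bpow_cexp Re_cexp ReD ImD !Re_mulr_real !Im_mulr_real.
have imE : (fun s => complex.Im (bpow a b s)) = (fun s => expR (P s) * sin (Q s)).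
  by apply/funext => s; rewrite bpow_cexp Im_cexp ReD ImD !Re_mulr_real !Im_mulr_real.
have dexp : is_derive t 1 (fun s => expR (P s))
    (expR (P t) * (complex.Re a * t^-1 - complex.Re b * (1 - t)^-1)).
  exact: (@is_derive1_comp _ expR P).
have dcos : is_derive t 1 (fun s => cos (Q s))
    (- sin (Q t) * (complex.Im a * t^-1 - complex.Im b * (1 - t)^-1)).
  exact: (@is_derive1_comp _ cos Q).
have dsin : is_derive t 1 (fun s => sin (Q s))
    (cos (Q t) * (complex.Im a * t^-1 - complex.Im b * (1 - t)^-1)).
  exact: (@is_derive1_comp _ sin Q).
have E : a * bker a (b + 1) t - b * bker (a + 1) b t =
    (a * (t^-1)%:C - b * ((1 - t)^-1)%:C) * bpow a b t.
  by rewrite /bker !addrK /bpow !cpow_sub1//; ring.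
have ER : complex.Re (bpow a b t) = expR (P t) * cos (Q t).
  by rewrite -[LHS]/((fun s => complex.Re (bpow a b s)) t) reE.
have EI : complex.Im (bpow a b t) = expR (P t) * sin (Q t).
  by rewrite -[LHS]/((fun s => complex.Im (bpow a b s)) t) imE.
rewrite reE imE E (ReM _ (bpow a b t)) (ImM _ (bpow a b t)) ER EI.
rewrite ReB ImB !Re_mulr_real !Im_mulr_real; split.
  have h : is_derive t 1 (fun s => expR (P s) * cos (Q s)) _ := is_deriveM dexp dcos.
  by apply: is_derive_eq h _; rewrite /GRing.scale /=; ring.
have h : is_derive t 1 (fun s => expR (P s) * sin (Q s)) _ := is_deriveM dexp dsin.
by apply: is_derive_eq h _; rewrite /GRing.scale /=; ring.
Qed.

Lemma continuous_bker a b : ccontinuous01 (bker a b).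
Proof. exact: cderivative_continuous (is_derive_bpow _ _). Qed.

Lemma expR_ln_le1 t p : 0 < t < 1 -> 0 <= p -> expR (p * ln t) <= 1.
Proof.
by move=> /andP[t0 t1] p0; rewrite expR_le1 mulr_ge0_le0// ln_le0// ltW.
Qed.

Lemma onem01 t : 0 < t < 1 -> 0 < 1 - t < 1.
Proof. by move=> /andP[t0 t1]; rewrite subr_gt0 t1 ltrBlDr ltrDl. Qed.

Lemma cderivativeZ (c : R) (F f : R -> R[i]) : cderivative01 F f ->
  cderivative01 (fun t => c%:C * F t) (fun t => c%:C * f t).
Proof.
move=> Ff t /Ff [h1 h2].
have reE (G : R -> R[i]) s : complex.Re (c%:C * G s) = c * complex.Re (G s).
  by case: (G s) => x y /=; rewrite mul0r subr0.
have imE (G : R -> R[i]) s : complex.Im (c%:C * G s) = c * complex.Im (G s).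
  by case: (G s) => x y /=; rewrite mul0r addr0.
rewrite !reE !imE; split.
  have -> : (fun s => complex.Re (c%:C * F s)) = (fun s => c * complex.Re (F s)).
    by apply/funext => s; rewrite reE.
  exact: is_deriveZ.
have -> : (fun s => complex.Im (c%:C * F s)) = (fun s => c * complex.Im (F s)).
  by apply/funext => s; rewrite imE.
exact: is_deriveZ.
Qed.

Lemma continuous_rker p q t : 0 < t < 1 -> {for t, continuous (rker p q)}.
Proof.
move=> t01; have -> : rker p q = (fun s => complex.Re (bker p%:C q%:C s)).
  by apply/funext => s; rewrite bker_real.
by have [] := continuous_bker p%:C q%:C t t01.
Qed.

Lemma integrable_rkerx1 p : 0 < p -> mu.-integrable I01 (EFin \o rker p 1).
Proof.
move=> p0; pose F t := complex.Re (p^-1%:C * bpow p%:C 0 t).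
have dF t : 0 < t < 1 -> is_derive t 1 F (rker p 1 t).
  move=> t01; have [h _] := cderivativeZ p^-1 _ _ (is_derive_bpow p%:C 0) t t01.
  apply: is_derive_eq h _; rewrite mul0r subr0 add0r mulrA -rmorphM mulVf ?gt_eqF//.
  by rewrite mul1r (bker_real p 1).
have bF t : 0 < t < 1 -> `|F t| <= p^-1.
  move=> t01; rewrite (le_trans (normr_Re_le _))// normcM normc_real normc_bpow.
  rewrite mul0r expR0 mulr1 ger0_norm ?invr_ge0 ?(ltW p0)// ler_piMr ?invr_ge0 ?(ltW p0)//.
  by rewrite expR_ln_le1// ltW.
exact (integrable_bounded_antiderivative (rker p 1) F p^-1
  (fun t _ => rker_ge0 p 1 t) (continuous_rker p 1) dF bF).
Qed.

Lemma integrable_rker1x q : 0 < q -> mu.-integrable I01 (EFin \o rker 1 q).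
Proof.
move=> q0; pose F t := complex.Re ((- q^-1)%:C * bpow 0 q%:C t).
have dF t : 0 < t < 1 -> is_derive t 1 F (rker 1 q t).
  move=> t01; have [h _] := cderivativeZ (- q^-1) _ _ (is_derive_bpow 0 q%:C) t t01.
  apply: is_derive_eq h _; rewrite mul0r sub0r add0r rmorphN mulrNN mulrA.
  by rewrite -rmorphM mulVf ?gt_eqF// mul1r (bker_real 1 q).
have bF t : 0 < t < 1 -> `|F t| <= q^-1.
  move=> t01; rewrite (le_trans (normr_Re_le _))// normcM normc_real normc_bpow.
  rewrite mul0r expR0 mul1r normrN ger0_norm ?invr_ge0 ?(ltW q0)//.
  by rewrite ler_piMr ?invr_ge0 ?(ltW q0)// expR_ln_le1 ?onem01// ltW.
exact (integrable_bounded_antiderivative (rker 1 q) F q^-1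
  (fun t _ => rker_ge0 1 q t) (continuous_rker 1 q) dF bF).
Qed.

(** Since 1 = t + (1 - t), the kernel is a sum of two kernels that are regular
    at one end each. *)
Lemma rker_le p q t : 0 < p -> 0 < q -> 0 < t < 1 ->
  rker p q t <= rker p 1 t + rker 1 q t.
Proof.
move=> p0 q0 t01; have [t0 t1] := in01P t t01.
rewrite /rker subrr !mul0r expR0 mulr1 mul1r.
have e (r u : R) : 0 < u -> expR (r * ln u) = expR ((r - 1) * ln u) * u.
  by move=> u0; rewrite -{3}(lnK u0) -expRD mulrBl mul1r subrK.
have hp := expR_ln_le1 t p t01 (ltW p0).
have hq := expR_ln_le1 (1 - t) q (onem01 t t01) (ltW q0).
rewrite e// in hp; rewrite e// in hq.
set X := expR ((p - 1) * ln t) in hp *; set Y := expR ((q - 1) * ln (1 - t)) in hq *.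
have X0 : 0 <= X by exact: expR_ge0.
have Y0 : 0 <= Y by exact: expR_ge0.
have -> : X * Y = X * (Y * (1 - t)) + (X * t) * Y by ring.
by rewrite lerD// ?ler_piMr// ler_piMl.
Qed.

Lemma integrable_rker p q : 0 < p -> 0 < q -> mu.-integrable I01 (EFin \o rker p q).
Proof.
move=> p0 q0; have mI : measurable (I01 : set (measurableTypeR R)) by [].
have ig := integrableD mI (integrable_rkerx1 p p0) (integrable_rker1x q q0).
apply: (le_integrable mI _ _ ig).
  apply/measurable_EFinP; apply: measurable_continuous01 => t.
  exact: continuous_rker.
move=> t; rewrite /= in_itv/= => t01; rewrite lee_fin ger0_norm ?rker_ge0//.
by rewrite (le_trans (rker_le p q t p0 q0 t01))// ler_norm.
Qed.

Lemma cintegrable_bker a b : 0 < complex.Re a -> 0 < complex.Re b ->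
  cintegrable I01 (bker a b).
Proof.
move=> a0 b0.
apply: (ccontinuous_integrable _ _ (continuous_bker a b) (integrable_rker _ _ a0 b0)).
by move=> t _; rewrite normc_bker.
Qed.

Lemma cintegral_bker_real p q :
  cintegral I01 (bker p%:C q%:C) = (Rintegral mu I01 (rker p q))%:C.
Proof.
rewrite /cintegral; congr (_ +i* _).
  by apply: eq_Rintegral => t _; rewrite bker_real.
rewrite (_ : Rintegral _ _ _ = Rintegral mu I01 (fun=> 0)).
  by rewrite /Rintegral integral0.
by apply: eq_Rintegral => t _; rewrite bker_real.
Qed.

End BetaKernel.

(** * Euler's beta integral *)

Section Beta.
Context {R : realType}.
Notation mu := (@lebesgue_measure R).
Implicit Types (a b : R[i]) (t p q : R).
Local Notation I01 := (`]0, 1[%classic : set R).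

Definition beta a b : R[i] := cintegral I01 (bker a b).

Lemma bker_succl a b t : 0 < t < 1 -> bker (a + 1) b t = t%:C * bker a b t.
Proof.
move=> /in01P[t0 _]; rewrite /bker /bpow.
have -> : a + 1 - 1 = a - 1 + 1 by ring.
by rewrite cpow_add1//; ring.
Qed.

Lemma bker_succr a b t : 0 < t < 1 -> bker a (b + 1) t = (1 - t)%:C * bker a b t.
Proof.
move=> /in01P[_ t1]; rewrite /bker /bpow.
have -> : b + 1 - 1 = b - 1 + 1 by ring.
by rewrite cpow_add1//; ring.
Qed.

Lemma rker_succr p q t : 0 < t < 1 -> rker p (q + 1) t = (1 - t) * rker p q t.
Proof.
move=> /in01P[_ t1]; rewrite /rker.
have -> : q + 1 - 1 = q - 1 + 1 by ring.
by rewrite [(_ + 1) * _]mulrDl mul1r expRD lnK ?posrE//; ring.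
Qed.

Lemma real_complexD1 (r : R) : r%:C + 1 = (r + 1)%:C.
Proof. by rewrite rmorphD rmorph1. Qed.

Lemma Re1D a : complex.Re (a + 1) = complex.Re a + 1.
Proof. by rewrite ReD. Qed.

Lemma Re_succ_gt0 a : 0 < complex.Re a -> 0 < complex.Re (a + 1).
Proof. by move=> a0; rewrite Re1D addr_gt0. Qed.

Lemma beta_split a b : 0 < complex.Re a -> 0 < complex.Re b ->
  beta a b = beta (a + 1) b + beta a (b + 1).
Proof.
move=> a0 b0; have a1 := Re_succ_gt0 a a0; have b1 := Re_succ_gt0 b b0.
rewrite /beta.
have [_ <-] := cintegrableD _ _ (cintegrable_bker _ _ a1 b0) (cintegrable_bker _ _ a0 b1).
apply: eq_cintegral => t t01; rewrite bker_succl// bker_succr// -mulrDl -rmorphD/=.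
by rewrite addrC subrK mul1r.
Qed.

Lemma cpow_inset_cvg0 a : 0 < complex.Re a ->
  (fun n => expR (complex.Re a * ln (inset n))) @ \oo --> (0 : R).
Proof.
move=> a0.
have -> : (fun n => expR (complex.Re a * ln (inset n))) =
    (fun n => inset n `^ complex.Re a).
  apply/funext => n; have /andP[i0 _] := @inset_bounds R n.
  by rewrite /powR gt_eqF.
have h := (cvg_at_rightP _ _ _).1 (powR_cvg0 a0).
apply: h; split; last exact: inset_cvg0.
by move=> n; have /andP[] := @inset_bounds R n.
Qed.

Lemma inset01 n : 0 < (inset n : R) < 1.
Proof.
have /andP[i0 i1] := @inset_bounds R n; rewrite i0/=.
by rewrite (lt_trans i1)// ltrBlDr ltrDl.
Qed.

Lemma bpow_cvg0_left a b : 0 < complex.Re a -> 0 <= complex.Re b ->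
  (fun n => bpow a b (inset n)) @ \oo --> (0 : R[i]^o).
Proof.
move=> a0 b0; apply/cvgCP; apply: cvg_le_dist (cpow_inset_cvg0 a a0) => n.
rewrite !subr0 ger0_norm ?normc_ge0// normc_bpow ler_piMr ?expR_ge0//.
by rewrite expR_ln_le1 ?onem01 ?inset01.
Qed.

Lemma bpow_cvg0_right a b : 0 <= complex.Re a -> 0 < complex.Re b ->
  (fun n => bpow a b (1 - inset n)) @ \oo --> (0 : R[i]^o).
Proof.
move=> a0 b0; have -> : (fun n => bpow a b (1 - inset n)) = (fun n => bpow b a (inset n)).
  by apply/funext => n; rewrite /bpow subKr mulrC.
exact: bpow_cvg0_left.
Qed.

(** The integrand of the difference is the derivative of t^a (1 - t)^b, which
    vanishes at both ends. *)
Lemma beta_by_parts a b : 0 < complex.Re a -> 0 < complex.Re b ->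
  a * beta a (b + 1) = b * beta (a + 1) b.
Proof.
move=> a0 b0; have a1 := Re_succ_gt0 a a0; have b1 := Re_succ_gt0 b b0.
have [i1 e1] := cintegrableZ a _ (cintegrable_bker _ _ a0 b1).
have [i2 e2] := cintegrableZ (- b) _ (cintegrable_bker _ _ a1 b0).
have [i3 e3] := cintegrableD _ _ i1 i2.
have eqf t : a * bker a (b + 1) t + - b * bker (a + 1) b t =
    a * bker a (b + 1) t - b * bker (a + 1) b t by rewrite mulNr.
have /eqP := @complex_improper_FTC _ (fun t => a * bker a (b + 1) t - b * bker (a + 1) b t)
  (bpow a b) 0 0 (ccontinuousB _ _ (ccontinuousZ _ _ (continuous_bker _ _))
    (ccontinuousZ _ _ (continuous_bker _ _))) (is_derive_bpow a b)
  (eq_cintegrable _ _ (fun t _ => eqf t) i3) (bpow_cvg0_left a b a0 (ltW b0))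
  (bpow_cvg0_right a b (ltW a0) b0).
rewrite -(eq_cintegral _ _ (fun t _ => eqf t)) e3 e1 e2 subr0 mulNr subr_eq0.
by move=> /eqP.
Qed.

Lemma beta_shift a b : 0 < complex.Re a -> 0 < complex.Re b ->
  a * beta a b = (a + b) * beta (a + 1) b.
Proof.
by move=> a0 b0; rewrite beta_split// mulrDr beta_by_parts// -mulrDl.
Qed.

(** From |e^w - 1| <= |Re w| + 2 |Im w| for Re w <= 0, and - ln t <= 1 / t - 1. *)
Lemma cpow_dist1_le a t : 0 < t < 1 -> 0 <= complex.Re a ->
  normc (cpow t a - 1) <= (complex.Re a + 2 * `|complex.Im a|) * ((1 - t) / t).
Proof.
move=> /andP[t0 t1] a0.
rewrite cpowE; apply: le_trans (normc_le_ReIm _) _.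
rewrite ReB ImB Re_cexp Im_cexp Re_mulr_real Im_mulr_real /= subr0.
set p := complex.Re a * ln t; set q := complex.Im a * ln t.
have l0 : ln t <= 0 by rewrite ln_le0// ltW.
have p0 : p <= 0 by rewrite /p mulr_ge0_le0.
have E1 : expR p <= 1 by rewrite expR_le1.
have E0 := expR_ge0 p.
have l1 : - ln t <= (1 - t) / t.
  have -> : (1 - t) / t = t^-1 - 1 by rewrite mulrBl mul1r divff// gt_eqF.
  rewrite -lnV ?posrE//; have := @le_ln1Dx R (t^-1 - 1); rewrite subrKC; apply.
  by rewrite ltrBrDl subrr invr_gt0.
have hA : `|expR p * cos q - 1| <= `|q| + - p.
  have -> : expR p * cos q - 1 = expR p * (cos q - 1) + (expR p - 1) by ring.
  rewrite (le_trans (ler_normD _ _))// lerD//.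
    rewrite normrM (ger0_norm E0) (le_trans _ (norm_cosB1_le q))//.
    by rewrite ler_piMl.
  by rewrite ler0_norm ?subr_le0// opprB lerBlDr; have := expR_ge1Dx p; lra.
have hB : `|expR p * sin q| <= `|q|.
  rewrite normrM (ger0_norm E0) (le_trans _ (norm_sin_le q))//.
  by rewrite ler_piMl.
have hq : `|q| = `|complex.Im a| * - ln t by rewrite /q normrM (ler0_norm l0).
apply: (le_trans (lerD hA hB)); rewrite hq /p.
have -> : `|complex.Im a| * - ln t + - (complex.Re a * ln t) + `|complex.Im a| * - ln t =
  (complex.Re a + 2 * `|complex.Im a|) * - ln t by ring.
by rewrite ler_wpM2l// addr_ge0// mulr_ge0.
Qed.

Lemma bpow0_cvg1 b : 0 <= complex.Re b ->
  (fun n => bpow 0 b (inset n)) @ \oo --> (1 : R[i]^o).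
Proof.
move=> b0; pose K := complex.Re b + 2 * `|complex.Im b|.
have K0 : 0 <= K by rewrite addr_ge0// mulr_ge0.
have h : (fun n => K * 2 * inset n) @ \oo --> (0 : R).
  by rewrite -(mulr0 (K * 2)); apply: cvgMr; exact: inset_cvg0.
apply/cvgCP; apply: cvg_le_dist h => n.
rewrite subr0 ger0_norm ?normc_ge0// /bpow cpow0 mul1r.
have i01 := inset01 n; have /andP[i0 i1] := @inset_bounds R n.
rewrite (le_trans (cpow_dist1_le _ _ (onem01 _ i01) b0))// -mulrA ler_wpM2l//.
rewrite subKr ler_pdivrMr; last by rewrite (lt_trans i0).
by rewrite mulrAC mulrC ler_peMr ?(ltW i0)//; lra.
Qed.

(** Integration by parts at a = 0, where the boundary term at 0 is 1. *)
Lemma beta_1l b : 0 < complex.Re b -> b * beta 1 b = 1.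
Proof.
move=> b0; have r1 : 0 < complex.Re (1 : R[i]) by exact: ltr01.
have [i2 e2] := cintegrableZ (- b) _ (cintegrable_bker _ _ r1 b0).
have eqf t : - b * bker 1 b t = 0 * bker 0 (b + 1) t - b * bker (0 + 1) b t.
  by rewrite mul0r sub0r add0r mulNr.
have := @complex_improper_FTC _ (fun t => 0 * bker 0 (b + 1) t - b * bker (0 + 1) b t)
  (bpow 0 b) 1 0 (ccontinuousB _ _ (ccontinuousZ _ _ (continuous_bker _ _))
    (ccontinuousZ _ _ (continuous_bker _ _))) (is_derive_bpow 0 b)
  (eq_cintegrable _ _ (fun t _ => eqf t) i2) (bpow0_cvg1 b (ltW b0))
  (bpow_cvg0_right 0 b (lexx 0) b0).
rewrite -(eq_cintegral _ _ (fun t _ => eqf t)) e2 sub0r mulNr => /oppr_inj.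
exact.
Qed.

Lemma beta_shiftn a b n : 0 < complex.Re a -> 0 < complex.Re b ->
  \prod_(k < n) (a + k%:R) * beta a b =
  \prod_(k < n) (a + b + k%:R) * beta (a + n%:R) b.
Proof.
move=> a0 b0; elim: n => [|n ih]; first by rewrite !big_ord0 addr0.
have an : 0 < complex.Re (a + n%:R) by rewrite Re_addn ltr_wpDr.
rewrite !big_ord_recr/= mulrAC ih -!mulrA; congr (_ * _).
by rewrite mulrC beta_shift// -natr1 !addrA [a + b + _]addrAC.
Qed.

(** At a positive integer the recurrence can be run down to 1, where the beta
    integral is elementary; this is why the Gauss product is itself a beta
    integral. *)
Lemma gauss_beta b n : 0 < complex.Re b ->
  cpow n%:R b * beta n.+1%:R b = gauss b n.
Proof.
move=> b0.
have r1 : 0 < complex.Re (1 : R[i]) by exact: ltr01.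
have h := beta_shiftn 1 b n r1 b0.
have Pn : \prod_(k < n) (1 + k%:R) = (n`!)%:R :> R[i].
  elim: n {h} => [|n ih]; first by rewrite big_ord0.
  by rewrite big_ord_recr/= ih factS natrM mulrC -natr1 [1 + _]addrC.
have P0 := prod_addC_neq0 b n.+1 b0.
rewrite /gauss; apply: (mulIf P0); rewrite divfK//.
have bb : b * (\prod_(k < n) (1 + b + k%:R)) = \prod_(k < n.+1) (b + k%:R).
  rewrite big_ord_recl/= addr0; congr (_ * _); apply: eq_bigr => k _.
  by rewrite /bump/= natrD addrA [b + 1]addrC.
rewrite -bb; move: h; rewrite Pn nat1r => h.
transitivity (cpow n%:R b * b * (\prod_(k < n) (1 + b + k%:R) * beta n.+1%:R b)).
  by ring.
by rewrite -h mulrACA beta_1l// mulr1 mulrC.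
Qed.

(** The kernels at (a + n + 2, b) and (n + 2, b) differ by the factor t^a - 1,
    which is O((1 - t) / t): the difference of the integrals is of the order of
    the real beta integral at (n + 1, Re b + 1), and integration by parts gains
    1 / (n + 1) over the Gauss product of Re b. *)
Lemma norm_cpow_beta_dist a b n : 0 < complex.Re a -> 0 < complex.Re b ->
  normc (cpow n.+1%:R b * beta (a + n.+2%:R) b - gauss b n.+1) <=
  2 * (complex.Re a + 2 * `|complex.Im a|) * complex.Re b * n.+1%:R^-1 *
  normc (gauss (complex.Re b)%:C n.+1).
Proof.
move=> a0 b0; pose K := complex.Re a + 2 * `|complex.Im a|.
have K0 : 0 <= K by rewrite addr_ge0 ?mulr_ge0// ltW.
have n1 : 0 < n.+1%:R :> R by rewrite ltr0n.
have an : 0 < complex.Re (a + n.+2%:R) by rewrite Re_addn ltr_wpDr.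
have nn : 0 < complex.Re (n.+2%:R : R[i]) by rewrite Re_natr ltr0n.
have b1 : 0 < complex.Re b + 1 by rewrite addr_gt0.
rewrite -gauss_beta// -mulrBr.
have [i2 e2] := cintegrableZ (-1) _ (cintegrable_bker _ _ nn b0).
have [i3 e3] := cintegrableD _ _ (cintegrable_bker _ _ an b0) i2.
have -> : beta (a + n.+2%:R) b - beta n.+2%:R b =
    cintegral I01 (fun t => bker (a + n.+2%:R) b t + -1 * bker n.+2%:R b t).
  by rewrite e3 e2 mulN1r.
have ig := integrable_rker _ _ n1 b1.
have mI : measurable (I01 : set (measurableTypeR R)) by [].
have iK : mu.-integrable I01 (EFin \o (fun t => K * rker n.+1%:R (complex.Re b + 1) t)).
  exact: eq_integrable (integrableZl mI K ig).
have bd t : 0 < t < 1 -> normc (bker (a + n.+2%:R) b t + -1 * bker n.+2%:R b t) <=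
    K * rker n.+1%:R (complex.Re b + 1) t.
  move=> t01; have [t0 t1] := in01P t t01.
  have -> : bker (a + n.+2%:R) b t + -1 * bker n.+2%:R b t =
      (cpow t a - 1) * (t%:C * bker n.+1%:R b t).
    rewrite -bker_succl// natr1 /bker /bpow -addrA (cpowD t a); ring.
  have eR : rker n.+1%:R (complex.Re b + 1) t = (1 - t) * normc (bker n.+1%:R b t).
    by rewrite rker_succr// normc_bker Re_natr.
  rewrite eR normcM (normcM t%:C) normc_real gtr0_norm// [K * _]mulrA [normc _ * (t * _)]mulrA.
  apply: ler_wpM2r; first exact: normc_ge0.
  rewrite -ler_pdivlMr// -mulrA; exact: cpow_dist1_le (ltW a0).
have h := normc_cintegral_le _ _ i3 iK bd.
have iE : Rintegral mu I01 (fun t => K * rker n.+1%:R (complex.Re b + 1) t) =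
    K * Rintegral mu I01 (rker n.+1%:R (complex.Re b + 1)).
  exact (@RintegralZl _ _ _ mu I01 _ K mI ig).
rewrite iE in h; set I := Rintegral mu I01 (rker _ _) in h.
have I0 : 0 <= I by apply: Rintegral_ge0 => t _; exact: rker_ge0.
have bI : beta n.+1%:R ((complex.Re b)%:C + 1) = I%:C.
  rewrite /beta real_complexD1 -[X in bker X](rmorph_nat (real_complex R)).
  exact: cintegral_bker_real.
have nn1 : 0 < complex.Re (n.+1%:R : R[i]) by rewrite Re_natr.
have EI : n.+1%:R * (expR (complex.Re b * ln n.+1%:R) * I) =
    complex.Re b * normc (gauss (complex.Re b)%:C n.+1).
  have := beta_by_parts n.+1%:R (complex.Re b)%:C nn1 b0.
  rewrite bI => /(congr1 (fun z => normc (cpow n.+1%:R (complex.Re b)%:C * z))).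
  rewrite [in RHS]mulrCA natr1 gauss_beta// normcM (normcM n.+1%:R) (normcM (complex.Re b)%:C).
  rewrite normc_cpow normc_real.
  rewrite (ger0_norm (ltW b0)) normc_real (ger0_norm I0) => <-.
  rewrite -(rmorph_nat (real_complex R)) normc_real ger0_norm//.
  by rewrite mulrCA.
rewrite normcM normc_cpow.
apply: (le_trans (ler_wpM2l (expR_ge0 _) h)).
rewrite (_ : _ * normc _ = 2 * K * (complex.Re b *
  normc (gauss (complex.Re b)%:C n.+1)) / n.+1%:R); last by rewrite /K; ring.
rewrite -EI le_eqVlt; apply/orP; left; apply/eqP.
move: (n.+1%:R : R) n1 => m m0; set e := expR _.
by field; rewrite gt_eqF.
Qed.

(** Euler's beta integral. The Gauss product of a + b is compared with that of
    a by n applications of the recurrence in a; what remains is n^b times the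
    beta integral at (a + n + 1, b), asymptotic to its value at (n + 1, b),
    which is exactly a Gauss product of b. *)
Lemma beta_Gamma a b : 0 < complex.Re a -> 0 < complex.Re b ->
  beta a b * Gamma (a + b) = Gamma a * Gamma b.
Proof.
move=> a0 b0; have ab0 : 0 < complex.Re (a + b) by rewrite ReD addr_gt0.
pose u n := cpow n.+1%:R b * beta (a + n.+2%:R) b.
have shift z : 0 < complex.Re z -> (fun n => gauss z n.+1) @ \oo --> (Gamma z : R[i]^o).
  by move=> z0; have := cvg_gauss z z0; rewrite -(@cvg_shiftS R[i]^o (gauss z)).
have du : (fun n => normc (u n - gauss b n.+1)) @ \oo --> (0 : R).
  have hg : (fun n => normc (gauss (complex.Re b)%:C n.+1)) @ \oo -->
    normc (Gamma (complex.Re b)%:C) by apply: cvgC_normc; exact: shift.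
  pose C := 2 * (complex.Re a + 2 * `|complex.Im a|) * complex.Re b.
  have h : (fun n => C * n.+1%:R^-1 * normc (gauss (complex.Re b)%:C n.+1)) @ \oo --> (0 : R).
    rewrite -(mul0r (normc (Gamma (complex.Re b)%:C))); apply: cvgM => //.
    by rewrite -(mulr0 C); apply: cvgMr; exact: cvg_harmonic.
  apply: cvg_le_dist h => n; rewrite subr0 ger0_norm ?normc_ge0//.
  exact: norm_cpow_beta_dist.
have ub : u @ \oo --> (Gamma b : R[i]^o).
  apply/cvgCP; have h := (cvgCP _ _).1 (shift b b0).
  have {}h : (fun n => normc (u n - gauss b n.+1) + normc (gauss b n.+1 - Gamma b))
      @ \oo --> (0 : R) by rewrite -(addr0 0); exact: cvgD.
  apply: cvg_le_dist h => n; rewrite subr0 ger0_norm ?normc_ge0//.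
  by apply: le_trans (ler_normcD _ _); rewrite addrA subrK.
have id n : beta a b * gauss (a + b) n.+1 = gauss a n.+1 * u n.
  have h := beta_shiftn a b n.+2 a0 b0.
  have P1 := prod_addC_neq0 a n.+2 a0; have P2 := prod_addC_neq0 (a + b) n.+2 ab0.
  rewrite /gauss /u cpowD; apply: (mulIf P2); apply: (mulIf P1).
  set p := \prod_(_ < _) (a + _) in h P1 *; set q := \prod_(_ < _) (a + b + _) in h P2 *.
  rewrite mulrA divfK//.
  transitivity (n.+1`!%:R * cpow n.+1%:R a * cpow n.+1%:R b * (p * beta a b)).
    by ring.
  rewrite h; by field.
have h1 : (fun n => beta a b * gauss (a + b) n.+1) @ \oo -->
    (beta a b * Gamma (a + b) : R[i]^o).
  by apply: cvgC_mul; [exact: (@cvg_cst R[i]^o) | exact: shift].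
have h2 : (fun n => gauss a n.+1 * u n) @ \oo --> (Gamma a * Gamma b : R[i]^o).
  by apply: cvgC_mul; [exact: shift | exact: ub].
rewrite -(climn_eq _ _ h1) -(climn_eq _ _ h2); congr climn.
by apply/funext => n; exact: id.
Qed.

End Beta.

(** * Interchange of double series and integral *)

Section SquareSums.

Definition sqsum (V : nmodType) (a : nat -> nat -> V) (N : nat) : V :=
  \sum_(m < N) \sum_(n < N) a m n.

Definition shell (V : nmodType) (a : nat -> nat -> V) (N : nat) : V :=
  \sum_(m < N) a m N + \sum_(n < N.+1) a N n.

(** The increments of the square partial sums are sums over shells, which are
    what domination by another double series controls. *)
Lemma sqsumS (V : nmodType) (a : nat -> nat -> V) N :
  sqsum V a N.+1 = sqsum V a N + shell V a N.
Proof.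
rewrite /sqsum /shell big_ord_recr/= addrA; congr (_ + _).
by rewrite -big_split /=; apply: eq_bigr => m _; rewrite big_ord_recr.
Qed.

End SquareSums.
Arguments sqsum {V}.
Arguments shell {V}.
Arguments sqsumS {V}.

Section Interchange.
Context {R : realType}.
Notation mu := (@lebesgue_measure R).
Local Notation I01 := (`]0, 1[%classic : set R).

Lemma sqsum_nd (b : nat -> nat -> R) : (forall m n, 0 <= b m n) ->
  nondecreasing_seq (sqsum b).
Proof.
move=> b0; apply/nondecreasing_seqP => N; rewrite sqsumS lerDl addr_ge0//;
  by apply: sumr_ge0.
Qed.

Lemma sqsum_cvg (a : nat -> nat -> R[i]) (b : nat -> nat -> R) (M : R) :
  (forall m n, normc (a m n) <= b m n) -> (forall N, sqsum b N <= M) ->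
  sqsum a @ \oo --> (dseries a : R[i]^o).
Proof.
move=> ab bM.
have h N : normc (sqsum a N.+1 - sqsum a N) <= sqsum b N.+1 - sqsum b N.
  rewrite !sqsumS [sqsum a N + _]addrC addrK [sqsum b N + _]addrC addrK.
  apply: le_trans (ler_normcD _ _) _; apply: lerD;
    apply: le_trans (ler_normc_sum _ _ _ _) _; apply: ler_sum => i _; exact: ab.
have [l hl] := cvgC_dominated (sqsum a) (sqsum b) M h bM.
by have -> : dseries a = l by exact: climn_eq.
Qed.

Lemma normc_sqsum_le (a : nat -> nat -> R[i]) (b : nat -> nat -> R) N :
  (forall m n, normc (a m n) <= b m n) -> normc (sqsum a N) <= sqsum b N.
Proof.
move=> ab; apply: le_trans (ler_normc_sum _ _ _ _) _; apply: ler_sum => m _.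
by apply: le_trans (ler_normc_sum _ _ _ _) _; apply: ler_sum => n _.
Qed.

Lemma cintegral_sqsum (f : nat -> nat -> R -> R[i]) N :
  (forall m n, cintegrable I01 (f m n)) ->
  cintegrable I01 (fun t => sqsum (fun m n => f m n t) N) /\
  cintegral I01 (fun t => sqsum (fun m n => f m n t) N) =
  sqsum (fun m n => cintegral I01 (f m n)) N.
Proof.
move=> fi.
have h m := cintegral_sum N (f m) (fi m).
have [h1 h2] := cintegral_sum N (fun m t => \sum_(n < N) f m n t) (fun m => (h m).1).
by split => //; rewrite h2; apply: eq_bigr => m _; exact: (h m).2.
Qed.

Lemma integrable_sqsum (g : nat -> nat -> R -> R) N :
  (forall m n, mu.-integrable I01 (EFin \o g m n)) ->
  mu.-integrable I01 (fun t => (sqsum (fun m n => g m n t) N)%:E) /\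
  (\int[mu]_(t in I01) (sqsum (fun m n => g m n t) N)%:E =
   (sqsum (fun m n => Rintegral mu I01 (g m n)) N)%:E)%E.
Proof.
move=> gi; have mI : measurable (I01 : set (measurableTypeR R)) by [].
have e1 m n : (\int[mu]_(t in I01) (g m n t)%:E = (Rintegral mu I01 (g m n))%:E)%E.
  by rewrite /Rintegral fineK//; exact: (@integrable_fin_num _ _ _ mu _ mI (EFin \o g m n) (gi m n)).
have s1 m : mu.-integrable I01 (fun t => \sum_(n < N) (EFin \o g m n) t)%E.
  by apply: (integrable_sum mI) => n _; exact: gi.
have s2 : mu.-integrable I01 (fun t => \sum_(m < N) \sum_(n < N) (EFin \o g m n) t)%E.
  by apply: (integrable_sum mI) => m _; exact: s1.
have eE t : (\sum_(m < N) \sum_(n < N) (EFin \o g m n) t)%E = (sqsum (fun m n => g m n t) N)%:E.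
  by rewrite /sqsum -sumEFin; apply: eq_bigr => m _; rewrite -sumEFin.
split; first by apply: eq_integrable s2 => // t _.
rewrite (_ : (\int[mu]_(t in I01) _)%E =
   (\int[mu]_(t in I01) \sum_(m < N) \sum_(n < N) (EFin \o g m n) t)%E); last first.
  by apply: eq_integral => t _; rewrite eE.
rewrite (integral_sum mI) => [|m]; last exact: s1.
rewrite /sqsum -sumEFin; apply: eq_bigr => m _.
rewrite (integral_sum mI) => [|n]; last exact: gi.
by rewrite -sumEFin; apply: eq_bigr => n _; exact: e1.
Qed.

(** Fubini for a double series on the unit interval: the dominating function
    is the sum of the nonnegative series, integrable by monotone convergence. *)
Lemma cintegral_dseries (f : nat -> nat -> R -> R[i]) (g : nat -> nat -> R -> R) (M : R) :
  (forall m n, cintegrable I01 (f m n)) ->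
  (forall m n, mu.-integrable I01 (EFin \o g m n)) ->
  (forall m n t, normc (f m n t) <= g m n t) ->
  (forall N, sqsum (fun m n => Rintegral mu I01 (g m n)) N <= M) ->
  (forall t, 0 < t < 1 -> exists Mt, forall N, sqsum (fun m n => g m n t) N <= Mt) ->
  cintegrable I01 (fun t => dseries (fun m n => f m n t)) /\
  dseries (fun m n => cintegral I01 (f m n)) =
    cintegral I01 (fun t => dseries (fun m n => f m n t)).
Proof.
move=> fi gi fg gM gt; have mI : measurable (I01 : set (measurableTypeR R)) by [].
pose T N t := sqsum (fun m n => g m n t) N.
pose F N t := sqsum (fun m n => f m n t) N.
pose S t := dseries (fun m n => f m n t).
have g0 m n t : 0 <= g m n t := le_trans (normc_ge0 _) (fg m n t).
have T0 N t : 0 <= T N t by rewrite sumr_ge0// => m _; rewrite sumr_ge0.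
have T0' N t : (0 <= (T N t)%:E)%E by rewrite lee_fin.
have ndT t : {homo (fun N => (T N t)%:E) : n m / (n <= m)%N >-> (n <= m)%E}.
  by move=> n m nm; rewrite lee_fin; exact: (sqsum_nd (fun m n => g m n t)).
have iT N := (integrable_sqsum g N gi).1.
have mT N : measurable_fun I01 (fun t => (T N t)%:E) := measurable_int _ (iT N).
pose G t := limn (fun N => (T N t)%:E).
have cT t : (fun N => (T N t)%:E) @ \oo --> ereal_sup (range (fun N => (T N t)%:E)).
  exact: (ereal_nondecreasing_cvgn (ndT t)).
have cTG t : (fun N => (T N t)%:E) @ \oo --> G t.
  by rewrite /G (cvg_lim _ (cT t)).
have TG N t : ((T N t)%:E <= G t)%E.
  by rewrite /G (cvg_lim _ (cT t))//; apply: ereal_sup_ubound; exists N.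
have G0 t : (0 <= G t)%E by apply: le_trans (TG 0%N t); rewrite lee_fin.
have mG : measurable_fun I01 G.
  exact: (emeasurable_fun_cvg _ _ mT (fun t _ => cTG t)).
have iG : mu.-integrable I01 G.
  apply/integrableP; split => //.
  rewrite (_ : (\int[mu]_(t in I01) `|G t|)%E = (\int[mu]_(t in I01) G t)%E); last first.
    by apply: eq_integral => t _; rewrite gee0_abs.
  rewrite (monotone_convergence mu mI mT); last 2 first.
  - by move=> N t _; rewrite lee_fin.
  - by move=> t _; exact: ndT.
  apply: (@le_lt_trans _ _ M%:E); last exact: ltry.
  apply: lime_le.
    apply: ereal_nondecreasing_is_cvgn => n m nm.
    exact (ge0_le_integral mu mI (fun t _ => T0' n t) (mT n) (mT m)
      (fun t _ => ndT t n m nm)).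
  by apply: nearW => N; rewrite (integrable_sqsum g N gi).2 lee_fin.
have FT N t : normc (F N t) <= T N t by exact: normc_sqsum_le.
have FS t : 0 < t < 1 -> (fun N => F N t) @ \oo --> (S t : R[i]^o).
  move=> t01; have [Mt hMt] := gt t t01.
  exact: (sqsum_cvg _ (fun m n => g m n t) Mt).
have key (phi : R[i] -> R) : (forall z, `|phi z| <= normc z) ->
    (forall t, 0 < t < 1 -> (fun N => phi (F N t)) @ \oo --> phi (S t)) ->
    (forall N, mu.-integrable I01 (fun t => (phi (F N t))%:E)) ->
    mu.-integrable I01 (fun t => (phi (S t))%:E) /\
    (fun N => Rintegral mu I01 (fun t => phi (F N t))) @ \oo -->
      Rintegral mu I01 (fun t => phi (S t)).
  move=> phin phic phii.
  have mphi N : measurable_fun I01 (fun t => (phi (F N t))%:E) := measurable_int _ (phii N).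
  have cphi t : I01 t -> (fun N => (phi (F N t))%:E) @ \oo --> (phi (S t))%:E.
    rewrite /= in_itv/= => t01; apply: cvg_EFin; first exact: nearW.
    exact: phic.
  have mS : measurable_fun I01 (fun t => (phi (S t))%:E).
    exact: (emeasurable_fun_cvg _ _ mphi cphi).
  have dom t N : I01 t -> (`|(phi (F N t))%:E| <= G t)%E.
    move=> _; apply: le_trans (TG N t); rewrite /= lee_fin.
    exact: le_trans (phin _) (FT N t).
  have [iS _ lS] := dominated_convergence mI mphi mS
    (aeW mu cphi) iG (aeW mu (fun t N => dom t N)).
  split => //; rewrite /Rintegral; apply: fine_cvg.
  by rewrite fineK//; exact: (@integrable_fin_num _ _ _ mu _ mI _ iS).
have iF N := cintegral_sqsum f N fi.
have [iR lR] := key (@complex.Re R) (@normr_Re_le R) (fun t t01 => cvgC_Re _ _ (FS t t01))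
  (fun N => (iF N).1.1).
have [iI lI] := key (@complex.Im R) (@normr_Im_le R) (fun t t01 => cvgC_Im _ _ (FS t t01))
  (fun N => (iF N).1.2).
split; first by split.
have e : sqsum (fun m n => cintegral I01 (f m n)) = (fun N => cintegral I01 (F N)).
  by apply/funext => N; rewrite (iF N).2.
have h : (sqsum (fun m n => cintegral I01 (f m n))) @ \oo --> (cintegral I01 S : R[i]^o).
  by rewrite e; exact: cvgC_ReIm.
exact: (climn_eq _ _ h).
Qed.

Lemma abs_convergent2_bound (a : nat -> nat -> R[i]) : abs_convergent2 a ->
  exists M, forall N, sqsum (fun m n => normc (a m n)) N <= M.
Proof.
rewrite /abs_convergent2 /summable; set e := esum _ _ => efin.
exists (fine e) => N.
have e0 : (0 <= e)%E by apply: esum_ge0 => p _; exact: abse_ge0.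
rewrite -lee_fin fineK ?ge0_fin_numE//; apply: esum_ge.
pose r := [seq (m, n) | m <- iota 0 N, n <- iota 0 N].
have ur : uniq r.
  by apply: allpairs_uniq; rewrite ?iota_uniq// => -[? ?] [? ?].
exists [set` r]; first by split => //; exact: finite_seq.
rewrite -fsbig_seq// big_allpairs /= /sqsum -sumEFin.
have io (F : nat -> \bar R) : (\sum_(i <- iota 0 N) F i = \sum_(i < N) F i)%E.
  by rewrite -(big_mkord xpredT F) /index_iota subn0.
rewrite io le_eqVlt; apply/orP; left; apply/eqP; apply: eq_bigr => m _.
rewrite io -sumEFin; apply: eq_bigr => n _.
by rewrite ger0_norm ?normc_ge0.
Qed.

End Interchange.

(** * Series of beta kernels *)

Section BetaSeries.
Context {R : realType}.
Notation mu := (@lebesgue_measure R).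
Local Notation I01 := (`]0, 1[%classic : set R).

(** Taking absolute values inside the beta integral at (a + s, b + r) costs
    only a factor independent of s and r. *)
Lemma rker_integral_le (a b : R[i]) : 0 < complex.Re a -> 0 < complex.Re b ->
  exists2 K : R, 0 <= K & forall s r : R, 0 <= s -> 0 <= r ->
  Rintegral mu I01 (rker (complex.Re a + s) (complex.Re b + r)) <=
  K * (normc (Gamma (a + s%:C)) * normc (Gamma (b + r%:C)) /
       normc (Gamma (a + b + (s + r)%:C))).
Proof.
move=> a0 b0.
pose k (z : R[i]) := normc (Gamma (complex.Re z)%:C) / normc (Gamma z).
have k0 z : 0 <= k z by rewrite mulr_ge0 ?invr_ge0 ?normc_ge0.
(* The quotient Gamma (Re z) / |Gamma z| at the left end bounds all the others. *)
have hk z s : 0 < complex.Re z -> 0 <= s ->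
    normc (Gamma (complex.Re z + s)%:C) <= k z * normc (Gamma (z + s%:C)).
  move=> z0 s0; rewrite /k mulrAC ler_pdivlMr; first exact: Gamma_ratio_anti.
  by rewrite normc_gt0 Gamma_neq0.
exists (k a * k b) => [|s r s0 r0]; first by rewrite mulr_ge0.
have as0 : 0 < complex.Re (complex.Re a + s)%:C by rewrite /= ltr_wpDr.
have br0 : 0 < complex.Re (complex.Re b + r)%:C by rewrite /= ltr_wpDr.
have I0 : 0 <= Rintegral mu I01 (rker (complex.Re a + s) (complex.Re b + r)).
  by apply: Rintegral_ge0 => t _; exact: rker_ge0.
have := beta_Gamma _ _ as0 br0; rewrite /beta cintegral_bker_real.
set I := Rintegral _ _ _ in I0 *.
move=> /(congr1 (@normc R)); rewrite normcM normc_real (ger0_norm I0) normcM => h.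
have ab0 : 0 < complex.Re (a + b + (s + r)%:C).
  by rewrite !ReD /= ltr_wpDr ?addr_gt0 ?addr_ge0.
have G0 : 0 < normc (Gamma (a + b + (s + r)%:C)) by rewrite normc_gt0 Gamma_neq0.
rewrite mulrA ler_pdivlMr//.
apply: (@le_trans _ _ (I * normc (Gamma ((complex.Re a + s)%:C + (complex.Re b + r)%:C)))).
  rewrite ler_wpM2l//; apply: le_trans (normc_Gamma_le _ ab0) _.
  rewrite (_ : (complex.Re _)%:C = (complex.Re a + s)%:C + (complex.Re b + r)%:C)//.
  by rewrite !ReD /= -rmorphD /=; congr (_ +i* _); ring.
by rewrite h mulrACA ler_pM ?normc_ge0// hk.
Qed.

(** Term by term integration of a double series of beta kernels whose
    exponents grow linearly: the bound on the absolute values of the integrated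
    terms is supplied by the absolute convergence of the integrated series. *)
Lemma dseries_bker (C : nat -> nat -> R[i]) (a b : R[i]) (al be : R) :
  0 < complex.Re a -> 0 < complex.Re b -> 0 < al -> 0 < be ->
  let u m := a + (al * m%:R)%:C in
  let v n := b + (be * n%:R)%:C in
  let D m n := C m n / Gamma (a + b + (al * m%:R + be * n%:R)%:C) in
  let f m n t := C m n / (Gamma (u m) * Gamma (v n)) * bker (u m) (v n) t in
  abs_convergent2 D ->
  (forall t, 0 < t < 1 ->
    exists M, forall N, sqsum (fun m n => normc (f m n t)) N <= M) ->
  cintegrable I01 (fun t => dseries (fun m n => f m n t)) /\
  dseries D = cintegral I01 (fun t => dseries (fun m n => f m n t)).
Proof.
move=> a0 b0 al0 be0 u v D f hD hf.
have nm m : 0 <= al * m%:R by rewrite mulr_ge0 ?(ltW al0).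
have nn n : 0 <= be * n%:R by rewrite mulr_ge0 ?(ltW be0).
have u0 m : 0 < complex.Re (u m) by rewrite ReD /= ltr_wpDr.
have v0 n : 0 < complex.Re (v n) by rewrite ReD /= ltr_wpDr.
have uv m n : u m + v n = a + b + (al * m%:R + be * n%:R)%:C.
  by rewrite /u /v addrACA -rmorphD.
pose g m n t := normc (f m n t).
pose c m n := normc (C m n / (Gamma (u m) * Gamma (v n))).
have gE m n t : g m n t = c m n * rker (complex.Re (u m)) (complex.Re (v n)) t.
  by rewrite /g /f normcM normc_bker.
have mI : measurable (I01 : set (measurableTypeR R)) by [].
have rI m n := integrable_rker _ _ (u0 m) (v0 n).
have gI m n : mu.-integrable I01 (EFin \o g m n).
  have -> : g m n = (fun t => c m n * rker (complex.Re (u m)) (complex.Re (v n)) t).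
    by apply/funext => t; rewrite gE.
  exact: eq_integrable (integrableZl mI (c m n) (rI m n)).
have gInt m n : Rintegral mu I01 (g m n) =
    c m n * Rintegral mu I01 (rker (complex.Re (u m)) (complex.Re (v n))).
  have -> : g m n = (fun t => c m n * rker (complex.Re (u m)) (complex.Re (v n)) t).
    by apply/funext => t; rewrite gE.
  exact (@RintegralZl _ _ _ mu I01 _ (c m n) mI (rI m n)).
have fI m n := cintegrableZ (C m n / (Gamma (u m) * Gamma (v n))) _
  (cintegrable_bker _ _ (u0 m) (v0 n)).
have [K K0 hK] := rker_integral_le a b a0 b0.
have [M hM] := abs_convergent2_bound _ hD.
have gD m n : Rintegral mu I01 (g m n) <= K * normc (D m n).
  rewrite gInt /c !ReD /=.
  apply: (le_trans (ler_wpM2l (normc_ge0 _) (hK _ _ (nm m) (nn n)))).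
  rewrite -/(u m) -/(v n) /D !normcM !normcV normcM.
  have pu : normc (Gamma (u m)) != 0 by rewrite normc_eq0 Gamma_neq0.
  have pv : normc (Gamma (v n)) != 0 by rewrite normc_eq0 Gamma_neq0.
  move: (normc (C m n)) (normc (Gamma (u m))) (normc (Gamma (v n))) pu pv => x p q p0 q0.
  set r := (normc _)^-1.
  have -> : x / (p * q) * (K * (p * q * r)) = K * (x * r) * (p * q / (p * q)) by ring.
  by rewrite divff ?mulf_neq0// mulr1.
have bndI N : sqsum (fun m n => Rintegral mu I01 (g m n)) N <= K * M.
  apply: (@le_trans _ _ (K * sqsum (fun m n => normc (D m n)) N)); last first.
    by rewrite ler_wpM2l.
  rewrite /sqsum mulr_sumr; apply: ler_sum => m _; rewrite mulr_sumr.
  by apply: ler_sum => n _; exact: gD.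
have [i1 i2] := cintegral_dseries f g (K * M) (fun m n => (fI m n).1) gI
  (fun m n t => lexx (g m n t)) bndI hf.
split => //; rewrite -i2; congr dseries; apply/funext => m; apply/funext => n.
rewrite /f (fI m n).2 -/(beta (u m) (v n)).
have h := beta_Gamma _ _ (u0 m) (v0 n).
have uv0 : 0 < complex.Re (u m + v n) by rewrite ReD addr_gt0.
have G1 := Gamma_neq0 _ uv0; have G2 := Gamma_neq0 _ (u0 m); have G3 := Gamma_neq0 _ (v0 n).
rewrite /D -uv; apply: (mulIf G1); rewrite divfK// -[RHS]mulrA h divfK//.
exact: mulf_neq0.
Qed.

Lemma dseriesZ (c : R[i]) (a : nat -> nat -> R[i]) (M : R) :
  (forall N, sqsum (fun m n => normc (a m n)) N <= M) ->
  dseries (fun m n => c * a m n) = c * dseries a.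
Proof.
move=> aM; have h := sqsum_cvg a (fun m n => normc (a m n)) M (fun m n => lexx _) aM.
have e : sqsum (fun m n => c * a m n) = (fun N => c * sqsum a N).
  apply/funext => N; rewrite /sqsum mulr_sumr; apply: eq_bigr => m _.
  by rewrite mulr_sumr.
have h' : sqsum (fun m n => c * a m n) @ \oo --> (c * dseries a : R[i]^o).
  by rewrite e; apply: cvgC_mul; [exact: (@cvg_cst R[i]^o) | exact: h].
exact: (climn_eq _ _ h').
Qed.

Lemma cpow_powRX (t al : R) (m : nat) : 0 < t ->
  ((t `^ al)%:C : R[i]) ^+ m = cpow t (al * m%:R)%:C.
Proof.
move=> t0; rewrite cpow_real -rmorphXn /= /powR gt_eqF//.
by rewrite -expRM_natr mulrAC.
Qed.

End BetaSeries.

Theorem mainTheorem7 (R : realType)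
    (gamma1 gamma2 gamma3 delta2 delta3 x y : R[i])
    (alpha1 alpha2 alpha3 alpha4 beta1 beta2 beta3 beta4 : R)
    (mu1 mu2 : R[i])
    (halpha1 : 0 < alpha1) (halpha2 : 0 < alpha2)
    (halpha3 : 0 < alpha3) (halpha4 : 0 < alpha4)
    (hbeta1 : 0 < beta1) (hbeta2 : 0 < beta2)
    (hbeta3 : 0 < beta3) (hbeta4 : 0 < beta4)
    (hmu1 : 0 < complex.Re mu1) (hmu2 : 0 < complex.Re mu2)
    (hD1 : abs_convergent2
      (D1_term gamma1 alpha1 beta1 gamma2 alpha2 gamma3 beta2
        (mu1 + mu2) alpha3 beta3 delta2 alpha4 delta3 beta4 x y))
    (hD2 : forall xi : R, 0 < xi < 1 -> abs_convergent2
      (D2_term gamma1 alpha1 beta1 gamma2 alpha2 gamma3 beta2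
        mu1 alpha3 mu2 beta3 delta2 alpha4 delta3 beta4
        (x * (xi `^ alpha3)%:C) (y * ((1 - xi) `^ beta3)%:C))) :
  let integrand (xi : R) : R[i] :=
    cpow xi (mu1 - 1) * cpow (1 - xi) (mu2 - 1) *
    D2 gamma1 alpha1 beta1 gamma2 alpha2 gamma3 beta2
      mu1 alpha3 mu2 beta3 delta2 alpha4 delta3 beta4
      (x * (xi `^ alpha3)%:C) (y * ((1 - xi) `^ beta3)%:C) in
  cintegrable `]0, 1[ integrand /\
  D1 gamma1 alpha1 beta1 gamma2 alpha2 gamma3 beta2
    (mu1 + mu2) alpha3 beta3 delta2 alpha4 delta3 beta4 x y =
  cintegral `]0, 1[ integrand.
Proof.
move=> integrand.
pose C m n := pochhammer gamma1 (alpha1 * m%:R + beta1 * n%:R) *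
  pochhammer gamma2 (alpha2 * m%:R) * pochhammer gamma3 (beta2 * n%:R) *
  (x ^+ m / Gamma (delta2 + (alpha4 * m%:R)%:C)) *
  (y ^+ n / Gamma (delta3 + (beta4 * n%:R)%:C)).
pose f m n t := C m n / (Gamma (mu1 + (alpha3 * m%:R)%:C) * Gamma (mu2 + (beta3 * n%:R)%:C)) *
  bker (mu1 + (alpha3 * m%:R)%:C) (mu2 + (beta3 * n%:R)%:C) t.
pose c t := cpow t (mu1 - 1) * cpow (1 - t) (mu2 - 1).
pose T t := D2_term gamma1 alpha1 beta1 gamma2 alpha2 gamma3 beta2
  mu1 alpha3 mu2 beta3 delta2 alpha4 delta3 beta4
  (x * (t `^ alpha3)%:C) (y * ((1 - t) `^ beta3)%:C).
have fE m n t : 0 < t < 1 -> f m n t = c t * T t m n.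
  move=> /in01P[t0 t1]; rewrite /f /c /T /D2_term /C /bker /bpow !exprMn !cpow_powRX//.
  rewrite ![_ + _ - 1]addrAC !(cpowD _ (_ - 1)).
  by ring.
have D1E : D1_term gamma1 alpha1 beta1 gamma2 alpha2 gamma3 beta2
    (mu1 + mu2) alpha3 beta3 delta2 alpha4 delta3 beta4 x y =
    (fun m n => C m n / Gamma (mu1 + mu2 + (alpha3 * m%:R + beta3 * n%:R)%:C)).
  by apply/funext => m; apply/funext => n; rewrite /D1_term /C; ring.
have fb t : 0 < t < 1 -> exists M, forall N, sqsum (fun m n => normc (f m n t)) N <= M.
  move=> t01; have [M hM] := abs_convergent2_bound _ (hD2 t t01).
  exists (normc (c t) * M) => N.
  apply: le_trans (ler_wpM2l (normc_ge0 (c t)) (hM N)).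
  rewrite /sqsum mulr_sumr; apply: ler_sum => m _; rewrite mulr_sumr.
  by apply: ler_sum => n _; rewrite fE// normcM.
have hC := hD1; rewrite D1E in hC.
have [h1 h2] := dseries_bker C mu1 mu2 alpha3 beta3 hmu1 hmu2 halpha3 hbeta3 hC fb.
(* The prefactor of the integrand is the beta kernel without the shifts. *)
have intE t : 0 < t < 1 -> dseries (fun m n => f m n t) = integrand t.
  move=> t01; have [M hM] := abs_convergent2_bound _ (hD2 t t01).
  rewrite /integrand /D2 -/(c t) -/(T t) -(dseriesZ _ _ M hM).
  by congr dseries; apply/funext => m; apply/funext => n; exact: fE.
split; first exact: eq_cintegrable intE h1.
by rewrite /D1 D1E h2; exact: eq_cintegral.
Qed.
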